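(* (1) The linear map $\chi_0:(\mathcal H,\overline{\sqcup\!\sqcup})\to\mathbb Q$ given by $$\chi_0(\mathbf 1)=1,\qquad \chi_0([s_1,\dots,s_k])=\frac{1}{(s_1+\cdots+s_k)!}$$ is a character. (2) Correspondingly, the homomorphism $\Psi_{\chi_0}$ is a Hopf algebra isomorphism from $(\mathcal H,\overline{\sqcup\!\sqcup},\Delta_{\ge1})$ to $(\mathcal H,\ast,\Delta_{\rm dec})$.
   Context: Let $\mathcal H=\mathbb Q\mathbf 1\oplus\bigoplus_{k\ge1,\ \vec s\in\mathbb Z_{\ge1}^k}\mathbb Q[\vec s]$ be the $\mathbb Q$-vector space with basis $\mathbf 1=[\emptyset]$ and the symbols $[\vec s]=[s_1,\dots,s_k]$. The depth of $[\vec s]$ is $\mathrm{dep}(\vec s)=k$ and its weight is $s_1+\cdots+s_k$ ($\mathbf 1$ has depth and weight $0$). Let $H_n$ be the set of basis elements of weight $n$; $\mathcal H=\bigoplus_{n\ge0}\mathbb Q H_n$ is the weight grading. Notation: $[1_k]=[1,\dots,1]$ ($k$ ones), $[1_0]=\mathbf 1$. MZV shuffle Hopf algebra $(\mathcal H,\overline{\sqcup\!\sqcup},\Delta_{\ge1})$. Let $\rho:\mathcal H\to\mathbb Q\oplus\mathbb Q\langle x_0,x_1\rangle x_1$ be the linear bijection $\mathbf 1\mapsto\mathbf 1$, $[s_1,\dots,s_k]\mapsto x_0^{s_1-1}x_1\cdots x_0^{s_k-1}x_1$. The product $\overline{\sqcup\!\sqcup}$ on $\mathcal H$ is the pullback along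 $\rho$ of the usual shuffle product of words in $x_0,x_1$ (defined by $w\sqcup\!\sqcup\mathbf 1=\mathbf 1\sqcup\!\sqcup w=w$, $aw_1\sqcup\!\sqcup bw_2=a(w_1\sqcup\!\sqcup bw_2)+b(aw_1\sqcup\!\sqcup w_2)$). For $i\ge1$ let $\delta_i:\mathcal H\to\mathcal H$ be linear with $\delta_i(\mathbf 1)=0$, $\delta_i([s_1,\dots,s_k])=\sum_{j=1}^i s_j[s_1,\dots,s_j+1,\dots,s_k]$ if $i\le k$, and $0$ if $i>k$; set $\delta_i=0$ for $i\le0$. Define $\mathrm{id}\,\circledS\,\delta_i:\mathcal H\otimes\mathcal H\to\mathcal H\otimes\mathcal H$ by $[\vec s]\otimes[\vec t]\mapsto[\vec s]\otimes\delta_{i-\mathrm{dep}(\vec s)}([\vec t])$. Then $\Delta_{\ge1}:\mathcal H\to\mathcal H\otimes\mathcal H$ is the unique linear map (known to exist) with $\Delta_{\ge1}(\mathbf 1)=\mathbf 1\otimes\mathbf 1$, $\Delta_{\ge1}([1_k])=\sum_{j=0}^k[1_j]\otimes[1_{k-j}]$, and $(\mathrm{id}\,\circledS\,\delta_i+\delta_i\otimes\mathrm{id})\Delta_{\ge1}=\Delta_{\ge1}\delta_i$ for all $i\ge1$. It is known that $(\mathcal H,\overline{\sqcup\!\sqcup},\Delta_{\ge1})$, with unit $\mathbf 1$ and counit $\mathbf 1\mapsto1$, $[\vec s]\mapsto0$, is a connected Hopf algebra graded by weight. MZV quasi-shuffle Hopf algebra $(\mathcal H,\ast,\Delta_{\rm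 dec})$. Regarding $[s_1,\dots,s_k]$ as a word in the letters $\mathbb Z_{\ge1}$, the product $\ast$ is defined by $w\ast\mathbf 1=\mathbf 1\ast w=w$, $aw_1\ast bw_2=a(w_1\ast bw_2)+b(aw_1\ast w_2)+(a+b)(w_1\ast w_2)$ for letters $a,b\in\mathbb Z_{\ge1}$ (where $a+b$ is a single letter), and $\Delta_{\rm dec}([s_1,\dots,s_k])=\sum_{i=0}^k[s_1,\dots,s_i]\otimes[s_{i+1},\dots,s_k]$; same unit, counit and weight grading. It is a connected graded Hopf algebra. A character of $(\mathcal H,\overline{\sqcup\!\sqcup})$ is a (unital) algebra homomorphism $\chi:(\mathcal H,\overline{\sqcup\!\sqcup})\to\mathbb Q$. Given such $\chi$, $\Psi_\chi:(\mathcal H,\overline{\sqcup\!\sqcup},\Delta_{\ge1})\to(\mathcal H,\ast,\Delta_{\rm dec})$ denotes the unique graded Hopf algebra homomorphism with $\chi_Q'\circ\Psi_\chi=\chi$, where $\chi_Q':(\mathcal H,\ast)\to\mathbb Q$ is the character $\chi_Q'(\mathbf 1)=1$, $\chi_Q'([s_1])=1$, $\chi_Q'([s_1,\dots,s_k])=0$ for $k>1$ (existence and uniqueness are known, by the Aguiar–Bergeron–Sottile universal property of quasi-symmetric functions). Explicitly, $\Psi_\chi(\mathbf 1)=\mathbf 1$ and for $[\vec s]\in H_n$, $n\ge1$, $\Psi_\chi([\vec s])=\sum_{\alpha}\chi_\alpha([\vec s])[\alpha_1,\dots,\alpha_m]$, summed over compositions $\alpha=(\alpha_1,\dots,\alpha_m)$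 of $n$, where $\chi_\alpha=\chi^{\otimes m}\circ\pi_\alpha\circ\Delta_{\ge1}^{(m-1)}$, $\Delta_{\ge1}^{(m-1)}:\mathcal H\to\mathcal H^{\otimes m}$ is the iterated coproduct ($\Delta_{\ge1}^{(0)}=\mathrm{id}$) and $\pi_\alpha:\mathcal H^{\otimes m}\to\mathbb QH_{\alpha_1}\otimes\cdots\otimes\mathbb QH_{\alpha_m}$ is the tensor product of the projections onto homogeneous components. *)

(* Defs.v *)
From HB Require Import structures.
From mathcomp Require Import all_boot all_order all_algebra.
From mathcomp Require Import finmap monalg.

Set Implicit Arguments.
Unset Strict Implicit.
Unset Printing Implicit Defensive.

Import GRing.Theory.
Local Open Scope ring_scope.

(* {malg rat[K]} is used only as the rational vector space with basis K; the   *)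
(* basis vector of k : K is << k >>.                                          *)

Section LinearExtension.

Variable K : choiceType.
Variable V : lmodType rat.

Definition linext (f : K -> V) (u : {malg rat[K]}) : V :=
  \sum_(k <- msupp u) u@_k *: f k.

Lemma linextEw (f : K -> V) (u : {malg rat[K]}) (d : {fset K}) :
  (msupp u `<=` d)%fset -> linext f u = \sum_(k <- d) u@_k *: f k.
Proof.
move=> le_ud; rewrite /linext (big_fset_incl _ le_ud) // => k _ /mcoeff_outdom ->.
by rewrite scale0r.
Qed.

Lemma linext_is_linear (f : K -> V) : linear (linext f).
Proof.
move=> a u v.
set d := (msupp u `|` msupp v `|` msupp (a *: u + v))%fset.
rewrite !(@linextEw f _ d).
- rewrite scaler_sumr -big_split /=; apply: eq_bigr => k _.
  by rewrite mcoeffD mcoeffZ scalerDl scalerA.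
- by apply/fsubsetP=> k; rewrite !inE => ->; rewrite orbT.
- by apply/fsubsetP=> k; rewrite !inE => ->.
- by apply/fsubsetP=> k; rewrite !inE => ->; rewrite orbT.
Qed.

HB.instance Definition _ (f : K -> V) :=
  GRing.isLinear.Build rat {malg rat[K]} V *:%R (linext f) (linext_is_linear f).

Lemma linextU (f : K -> V) (k : K) : linext f << k >> = f k.
Proof. by rewrite /linext msuppU oner_eq0 big_seq_fset1 mcoeffUU scale1r. Qed.

Lemma malg_linear_ext (f g : {linear {malg rat[K]} -> V}) :
  (forall k, f << k >> = g << k >>) -> f =1 g.
Proof.
move=> fg u; rewrite [u]monalgE !linear_sum; apply: eq_bigr => k _.
have -> : << u@_k *g k >> = u@_k *: << k >> :> {malg rat[K]}.
  by apply/malgP=> l; rewrite mcoeffZ !mcoeffU; case: eqP => _; rewrite ?mulr1 ?mulr0.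
by rewrite !linearZ fg.
Qed.

End LinearExtension.

Definition bilinext (K L : choiceType) (V : lmodType rat) (f : K -> L -> V)
    (u : {malg rat[K]}) (v : {malg rat[L]}) : V :=
  linext (fun k => linext (f k) v) u.

Lemma bilinextU (K L : choiceType) (V : lmodType rat) (f : K -> L -> V) k l :
  bilinext f << k >> << l >> = f k l.
Proof. by rewrite /bilinext !linextU. Qed.

Lemma bilinext_is_linearr (K L : choiceType) (V : lmodType rat)
  (f : K -> L -> V) u : linear (bilinext f u).
Proof.
move=> a v w; rewrite /bilinext /linext scaler_sumr -big_split /=.
apply: eq_bigr => k _; rewrite -/(linext (f k) _) linearP /= scalerDr.
by rewrite !scalerA mulrC.
Qed.

HB.instance Definition _ (K L : choiceType) (V : lmodType rat)
    (f : K -> L -> V) u :=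
  GRing.isLinear.Build rat {malg rat[L]} V *:%R (bilinext f u)
    (bilinext_is_linearr f u).

Notation letter := {n : nat | (0 < n)%N}.

Definition lone : letter := exist _ 1%N isT.
Definition ladd (a b : letter) : letter :=
  exist _ (val a + val b)%N (ltn_addr (val b) (valP a)).

Notation composition := (seq letter).

Definition weight (s : composition) : nat := sumn (map val s).
Definition ones (k : nat) : composition := nseq k lone.

Notation calH := {malg rat[composition]}.
(* H tensor H has basis the pairs of basis elements. *)
Notation calH2 := {malg rat[(composition * composition)%type]}.

Definition unitH : calH := << [::] : composition >>.
Definition counitH : calH -> rat := fun u => u@_([::] : composition).

Definition tens : calH -> calH -> calH2 := bilinext (fun s t => << (s, t) >>).

Definition tens_map (f g : calH -> calH) : calH2 -> calH2 :=
  linext (fun st => tens (f << st.1 >>) (g << st.2 >>)).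

Definition homogeneous (n : nat) (u : calH) : Prop :=
  {in msupp u, forall s, weight s = n}.

(* Shuffle product of words in x_0 = false, x_1 = true; the terms of u sh v   *)
(* are listed with multiplicity.                                              *)

Notation word := (seq bool).

Fixpoint shuffles (u : word) : word -> seq word :=
  fix shuffles_u (v : word) : seq word :=
    match u, v with
    | [::], _ => [:: v]
    | _, [::] => [:: u]
    | a :: u', b :: v' =>
        map (cons a) (shuffles u' v) ++ map (cons b) (shuffles_u v')
    end.

Definition shuffle : {malg rat[word]} -> {malg rat[word]} -> {malg rat[word]} :=
  bilinext (fun u v => \sum_(w <- shuffles u v) << w >>).

Definition rho_word (s : composition) : word :=
  flatten [seq rcons (nseq (val a).-1 false) true | a <- s].

(* Inverse of rho_word on words that are empty or end in x_1; trailing x_0's  *)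
(* are dropped, and n counts the x_0's read since the last x_1.               *)
Fixpoint unrho_word_rec (n : nat) (w : word) : composition :=
  match w with
  | [::] => [::]
  | false :: w' => unrho_word_rec n.+1 w'
  | true :: w' => exist _ n.+1 (ltn0Sn n) :: unrho_word_rec 0 w'
  end.
Definition unrho_word : word -> composition := unrho_word_rec 0.

Definition rho : calH -> {malg rat[word]} := linext (fun s => << rho_word s >>).
Definition unrho : {malg rat[word]} -> calH := linext (fun w => << unrho_word w >>).

(* The pullback of shuffle along rho: see rho_shb below.                      *)
Definition shb (u v : calH) : calH := unrho (shuffle (rho u) (rho v)).

Fixpoint stuffles (u : composition) : composition -> seq composition :=
  fix stuffles_u (v : composition) : seq composition :=
    match u, v with
    | [::], _ => [:: v]
    | _, [::] => [:: u]
    | a :: u', b :: v' =>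
        map (cons a) (stuffles u' v) ++ map (cons b) (stuffles_u v')
        ++ map (cons (ladd a b)) (stuffles u' v')
    end.

Definition stuffle : calH -> calH -> calH :=
  bilinext (fun u v => \sum_(w <- stuffles u v) << w >>).

Definition Delta_dec : calH -> calH2 :=
  linext (fun s => \sum_(i < (size s).+1) << (take i s, drop i s) >>).

(* s_j |-> s_j + 1, positions counted from 0 *)
Definition raise (j : nat) (s : composition) : composition :=
  set_nth lone s j (ladd (nth lone s j) lone).

Definition delta_basis (i : nat) (s : composition) : calH :=
  if (i <= size s)%N
  then \sum_(j < i) (val (nth lone s j))%:R *: << raise j s >> else 0.

Definition delta (i : nat) : calH -> calH := linext (delta_basis i).

(* Truncated subtraction is harmless, because delta 0 = 0. *)
Definition id_circS_delta (i : nat) : calH2 -> calH2 :=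
  linext (fun st => tens << st.1 >> (delta (i - size st.1) << st.2 >>)).

(* Exactly one linear map satisfies this: see Delta_ge1_exists and            *)
(* Delta_ge1_unique below.                                                    *)
Record is_Delta_ge1 (Delta : {linear calH -> calH2}) : Prop := IsDeltaGe1 {
  Delta_ge1_1 : Delta unitH = tens unitH unitH;
  Delta_ge1_ones : forall k : nat,
    Delta << ones k >>
    = \sum_(j < k.+1) tens << ones j >> << ones (k - j) >>;
  Delta_ge1_delta : forall (i : nat) (u : calH), (1 <= i)%N ->
    id_circS_delta i (Delta u) + tens_map (delta i) id (Delta u)
    = Delta (delta i u)
}.

Definition is_character (mul : calH -> calH -> calH) (chi : {linear calH -> rat^o}) : Prop :=
  chi unitH = 1 /\ (forall u v : calH, chi (mul u v) = chi u * chi v).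

(* Compatibility with antipodes is automatic for bialgebra morphisms between  *)
(* Hopf algebras.                                                             *)
Record is_hopf_hom (mul1 : calH -> calH -> calH) (Delta1 : calH -> calH2)
    (mul2 : calH -> calH -> calH) (Delta2 : calH -> calH2) (f : {linear calH -> calH}) : Prop :=
  IsHopfHom {
    hopf_hom_unit : f unitH = unitH;
    hopf_hom_mul : forall u v : calH, f (mul1 u v) = mul2 (f u) (f v);
    hopf_hom_counit : forall u : calH, counitH (f u) = counitH u;
    hopf_hom_comul : forall u : calH, Delta2 (f u) = tens_map f f (Delta1 u)
  }.

Definition is_hopf_iso (mul1 : calH -> calH -> calH) (Delta1 : calH -> calH2)
    (mul2 : calH -> calH -> calH) (Delta2 : calH -> calH2) (f : {linear calH -> calH}) : Prop :=
  is_hopf_hom mul1 Delta1 mul2 Delta2 f /\ bijective f.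

Definition is_graded (f : calH -> calH) : Prop :=
  forall (n : nat) (u : calH), homogeneous n u -> homogeneous n (f u).

Definition chiQ : calH -> rat^o := linext (fun s => ((size s <= 1)%N)%:R : rat^o).
HB.instance Definition _ := GRing.Linear.on chiQ.

Definition is_Psi (Delta : calH -> calH2) (chi : calH -> rat) (Psi : {linear calH -> calH}) :
    Prop :=
  [/\ is_hopf_hom shb Delta stuffle Delta_dec Psi,
      is_graded Psi
    & forall u : calH, chiQ (Psi u) = chi u].

Definition chi0 : calH -> rat^o :=
  linext (fun s => (((weight s)`!)%:R)^-1 : rat^o).
HB.instance Definition _ := GRing.Linear.on chi0.

Definition ends_x1 (w : word) : bool := last true w.

Lemma unrho_word_nseq n m w :
  unrho_word_rec n (nseq m false ++ w) = unrho_word_rec (n + m) w.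
Proof. by elim: m n => [|m IH] n /=; rewrite ?addn0 ?IH ?addnS. Qed.

Lemma rho_word_cons a s :
  rho_word (a :: s) = nseq (val a).-1 false ++ true :: rho_word s.
Proof. by rewrite /rho_word /= -cats1 -catA. Qed.

Lemma rho_wordK : cancel rho_word unrho_word.
Proof.
rewrite /unrho_word; elim=> // a s IH.
rewrite rho_word_cons unrho_word_nseq add0n /= IH; congr (_ :: _).
by apply: val_inj; case: a => -[].
Qed.

Lemma unrho_wordK w : ends_x1 w -> rho_word (unrho_word w) = w.
Proof.
have aux n v : last true v ->
    rho_word (unrho_word_rec n v) =
    (if v is [::] then [::] else nseq n false ++ v).
  elim: v n => //= b v IH n; case: b => /= lv.
    by rewrite rho_word_cons (IH 0%N) //; case: v lv {IH}.
  rewrite IH; last by case: v lv {IH}.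
  by case: v lv {IH} => // c v _; elim: n => //= n ->.
by move=> ew; rewrite /unrho_word aux //; case: w ew.
Qed.

Lemma ends_rho_word s : ends_x1 (rho_word s).
Proof.
rewrite /ends_x1.
suff H b : last b (rho_word s) = if s is [::] then b else true by rewrite H; case: (s).
elim: s b => // a s IH b; rewrite rho_word_cons last_cat /= IH.
by case: s {IH}.
Qed.

Lemma ends_shuffles u v w :
  ends_x1 u -> ends_x1 v -> w \in shuffles u v -> ends_x1 w.
Proof.
elim: u v w => [|a u IHu] v w; first by case: v => [|b v] _ ?; rewrite inE => /eqP->.
elim: v w => [|b v IHv] w eu ev; first by rewrite inE => /eqP->.
have eu' : ends_x1 u by move: eu; rewrite /ends_x1 /=; case: (u).
have ev' : ends_x1 v by move: ev; rewrite /ends_x1 /=; case: (v).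
have cons_ends c x : x != [::] -> ends_x1 x -> ends_x1 (c :: x) by case: x.
rewrite /= mem_cat => /orP[] /mapP[x xin ->]; last first.
  apply: cons_ends; last exact: IHv.
  apply: contraTneq xin => ->; case: (v) => // c v'.
  by rewrite /= mem_cat; apply/negP=> /orP[] /mapP[].
apply: cons_ends; last exact: IHu xin.
apply: contraTneq xin => ->; case: (u) => // c u'.
by rewrite /= mem_cat; apply/negP=> /orP[] /mapP[].
Qed.

HB.instance Definition _ := GRing.Linear.on rho.
HB.instance Definition _ := GRing.Linear.on unrho.

Lemma rho_shb u v : rho (shb u v) = shuffle (rho u) (rho v).
Proof.
rewrite /shb /shuffle.
pose F (w1 w2 : word) : {malg rat[word]} := \sum_(w <- shuffles w1 w2) << w >>.
rewrite -!/(bilinext F _ _).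
pose fl (w : {malg rat[word]}) : {linear {malg rat[word]} -> {malg rat[word]}} :=
  linext (fun k => linext (F k) w).
apply: (malg_linear_ext (f := rho \o (unrho \o (fl (rho v) \o rho)))
                        (g := fl (rho v) \o rho)) u => s /=.
apply: (malg_linear_ext
         (f := rho \o (unrho \o (bilinext F (rho << s >>) \o rho)))
         (g := bilinext F (rho << s >>) \o rho)) v => t /=.
rewrite {2 3 4 5}/rho !linextU bilinextU /F.
rewrite [X in rho X](linear_sum [the {linear _ -> _} of unrho]).
rewrite [LHS](linear_sum [the {linear _ -> _} of rho]).
apply: eq_big_seq => w ws; rewrite /= /unrho linextU /rho linextU unrho_wordK //.
by apply: ends_shuffles ws; apply: ends_rho_word.
Qed.

HB.instance Definition _ u := GRing.Linear.on (tens u).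
HB.instance Definition _ i := GRing.Linear.on (delta i).

Definition tensl (v u : calH) : calH2 := tens u v.
Lemma tensl_is_linear v : linear (tensl v).
Proof. by move=> a u w; rewrite /tensl /tens /bilinext linearP. Qed.
HB.instance Definition _ v :=
  GRing.isLinear.Build rat calH calH2 *:%R (tensl v) (tensl_is_linear v).

Lemma tens0l v : tens 0 v = 0.
Proof. exact: (linear0 (tensl v)). Qed.

Lemma tens_suml n (c : 'I_n -> rat) (F : 'I_n -> calH) v :
  tens (\sum_i c i *: F i) v = \sum_i c i *: tens (F i) v.
Proof.
rewrite -[LHS]/(tensl v _) linear_sum; apply: eq_bigr => i _.
exact: linearZ.
Qed.

Lemma tensU s t : tens << s >> << t >> = << (s, t) >>.
Proof. exact: bilinextU. Qed.

Lemma delta0 u : delta 0 u = 0.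
Proof.
rewrite /delta /linext big1 // => s _.
by rewrite /delta_basis leq0n big_ord0 scaler0.
Qed.

Lemma size_raise j s : (j < size s)%N -> size (raise j s) = size s.
Proof. by move=> js; rewrite size_set_nth; apply/maxn_idPr. Qed.

Lemma delta_small i s : (i <= size s)%N ->
  delta i << s >> = \sum_(j < i) (val (nth lone s j))%:R *: << raise j s >>.
Proof. by move=> le; rewrite /delta linextU /delta_basis le. Qed.

Lemma delta_large i s : (size s < i)%N -> delta i << s >> = 0.
Proof. by move=> lt; rewrite /delta linextU /delta_basis leqNgt lt. Qed.

Lemma delta_comm i m s : delta i (delta m << s >>) = delta m (delta i << s >>).
Proof.
wlog le_im : i m / (i <= m)%N.
  by move=> H; case/orP: (leq_total i m) => /H.
case: (leqP m (size s)) => ms; last first.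
  rewrite (delta_large ms) linear0; case: (leqP i (size s)) => is_.
    rewrite delta_small // linear_sum big1 // => j _; rewrite linearZ /=.
    by rewrite delta_large ?scaler0 // size_raise // (leq_trans (ltn_ord j)).
  by rewrite (delta_large is_) linear0.
have is_ := leq_trans le_im ms.
rewrite (delta_small ms) (delta_small is_) !linear_sum /=.
have expand a b (j : 'I_a) : (a <= size s)%N -> (b <= size s)%N ->
    delta b ((val (nth lone s j))%:R *: << raise j s >>) =
    \sum_(l < b) (val (nth lone s j) * val (nth lone (raise j s) l))%:R
       *: << raise l (raise j s) >>.
  move=> las lbs; have js : (j < size s)%N by apply: leq_trans las.
  rewrite linearZ /= delta_small ?size_raise // scaler_sumr.
  by apply: eq_bigr => l _; rewrite scalerA natrM.
rewrite (eq_bigr _ (fun j _ => expand _ _ j ms is_)).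
rewrite (eq_bigr _ (fun j _ => expand _ _ j is_ ms)) exchange_big /=.
apply: eq_bigr => l _; apply: eq_bigr => j _.
rewrite /raise !nth_set_nth /=; case: (eqVneq (l : nat) j) => [->|ne] //=.
by rewrite set_set_nth eq_sym (negPf ne) mulnC.
Qed.

Definition delta2_basis (i : nat) (st : composition * composition) : calH2 :=
  tens << st.1 >> (delta (i - size st.1) << st.2 >>)
  + tens (delta i << st.1 >>) << st.2 >>.
Definition delta2 (i : nat) : calH2 -> calH2 := linext (delta2_basis i).
HB.instance Definition _ i := GRing.Linear.on (delta2 i).

Lemma delta2E i u :
  delta2 i u = id_circS_delta i u + tens_map (delta i) id u.
Proof.
rewrite /delta2 /id_circS_delta /tens_map /linext -big_split /=.
by apply: eq_bigr => st _; rewrite -scalerDr.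
Qed.

Lemma delta2_0 u : delta2 0 u = 0.
Proof.
rewrite /delta2 /linext big1 // => st _; rewrite /delta2_basis sub0n !delta0.
by rewrite linear0 tens0l addr0 scaler0.
Qed.

Lemma delta2_tens i s v : delta2 i (tens << s >> v) =
  tens << s >> (delta (i - size s) v) + tens (delta i << s >>) v.
Proof.
pose G (w : calH) : calH2 :=
  tens << s >> (delta (i - size s) w) + tens (delta i << s >>) w.
have lG : linear G.
  by move=> a x y; rewrite /G !linearP scalerDr addrACA.
pose GL := GRing.isLinear.Build _ _ _ _ G lG.
pose G' : {linear _ -> _} := HB.pack G GL.
apply: (malg_linear_ext (f := delta2 i \o tens << s >>) (g := G')) v => t /=.
by rewrite tensU /delta2 linextU.
Qed.

Lemma delta2_tens_delta i m s t :
  delta2 i (tens (delta m << s >>) << t >>) =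
  tens (delta m << s >>) (delta (i - size s) << t >>)
  + tens (delta i (delta m << s >>)) << t >>.
Proof.
case: (leqP m (size s)) => ms; last first.
  rewrite delta_large // linear0 !(tens0l,linear0).
  by rewrite addr0.
rewrite delta_small // [X in _ + tens X _](linear_sum (delta i)).
under [X in _ + tens X _]eq_bigr do rewrite linearZ /=.
rewrite !tens_suml [LHS](linear_sum (delta2 i)) -big_split /=.
apply: eq_bigr => j _; rewrite linearZ /= -scalerDr delta2_tens.
by rewrite size_raise // (leq_trans _ ms).
Qed.

Lemma delta2_comm i m x : delta2 i (delta2 m x) = delta2 m (delta2 i x).
Proof.
apply: (malg_linear_ext (f := delta2 i \o delta2 m)
                        (g := delta2 m \o delta2 i)) x => -[s t] /=.
have delta2D a x y : delta2 a (x + y) = delta2 a x + delta2 a y.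
  exact: raddfD.
have E a b : delta2 a (delta2 b << (s, t) >>) =
    tens << s >> (delta (a - size s) (delta (b - size s) << t >>))
    + tens (delta a << s >>) (delta (b - size s) << t >>)
    + (tens (delta b << s >>) (delta (a - size s) << t >>)
       + tens (delta a (delta b << s >>)) << t >>).
  rewrite -tensU (delta2_tens b s << t >>) delta2D.
  exact: (congr2 +%R (delta2_tens _ _ _) (delta2_tens_delta _ _ _ _)).
apply: (etrans (E i m)); rewrite addrACA; apply: (etrans _ (esym (E m i))).
have Et := congr1 (tens << s >>) (delta_comm (i - size s) (m - size s) t).
have Es := congr1 (fun u => tens u << t >>) (delta_comm i m s).
exact: (congr2 +%R (congr1 (+%R^~ _) Et) (congr1 (+%R _) Es)).
Qed.

Definition delta2_diff j x := delta2 j.+1 x - delta2 j x.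
Lemma delta2_diff_is_linear j : linear (delta2_diff j).
Proof.
move=> a x y; rewrite /delta2_diff.
have L i : delta2 i (a *: x + y) = a *: delta2 i x + delta2 i y.
  exact: linearP.
by rewrite !L scalerBr opprD addrACA.
Qed.
HB.instance Definition _ j :=
  GRing.isLinear.Build rat calH2 calH2 *:%R (delta2_diff j)
    (delta2_diff_is_linear j).

Lemma delta2_diff_comm i j x :
  delta2_diff i (delta2_diff j x) = delta2_diff j (delta2_diff i x).
Proof.
have dB a : {morph delta2 a : y z / y - z} by exact: raddfB.
move: dB delta2_comm; rewrite /delta2_diff; move: delta2 => d dB dC.
rewrite !dB !(dC i) !(dC i.+1) !opprB addrACA [in RHS]addrACA.
by congr (_ + _); rewrite addrC.
Qed.

Lemma iter_comm (T : Type) (f g : T -> T) :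
  (forall x, f (g x) = g (f x)) -> forall n x, f (iter n g x) = iter n g (f x).
Proof. by move=> fg; elim=> //= n IH x; rewrite fg IH. Qed.

Fixpoint Delta_rec (i : nat) (s : composition) (x : calH2) : calH2 :=
  if s is a :: s' then
    ((val a).-1`!)%:R^-1 *: iter (val a).-1 (delta2_diff i) (Delta_rec i.+1 s' x)
  else x.

Lemma Delta_rec_comm (f : {linear calH2 -> calH2}) :
    (forall m x, f (delta2 m x) = delta2 m (f x)) ->
  forall i s x, f (Delta_rec i s x) = Delta_rec i s (f x).
Proof.
move=> fd i s x; have fdd j y : f (delta2_diff j y) = delta2_diff j (f y).
  by rewrite /delta2_diff raddfB; apply: (congr2 (fun u v => u - v)); apply: fd.
elim: s i => [|a s IH] i //=; apply: (etrans (linearZ _ _)).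
by apply: congr1; apply: (etrans (iter_comm (fdd i) _ _)); rewrite -IH.
Qed.

Lemma Delta_rec_raise i j s x : (j < size s)%N ->
  (val (nth lone s j))%:R *: Delta_rec i (raise j s) x
  = delta2_diff (i + j) (Delta_rec i s x).
Proof.
elim: s i j => // a s IH i [_ |j js]; rewrite /raise /=.
  rewrite addn0 addn1; case: a => -[//|n] ? /=.
  apply: (etrans _ (esym (linearZ _ _))).
  rewrite scalerA factS natrM invfM mulrA divff ?mul1r //.
  by rewrite Num.Theory.pnatr_eq0.
have IHj := IH i.+1 j js.
apply: (etrans _ (esym (linearZ _ _))).
rewrite scalerA mulrC -scalerA addnS -addSn; apply: congr1.
have E c : {morph delta2_diff i : y / c *: y}.
  by move=> y; exact: linearZ.
rewrite (iter_comm (f := *:%R _) (fun y => esym (E _ y))) IHj.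
by apply/esym/iter_comm => y; apply: delta2_diff_comm.
Qed.

Definition Delta_ones (k : nat) : calH2 :=
  \sum_(j < k.+1) tens << ones j >> << ones (k - j) >>.

Lemma delta2_ones i k : (k < i)%N -> delta2 i (Delta_ones k) = 0.
Proof.
move=> ki; apply: (etrans (raddf_sum (delta2 i) _ _ _)).
rewrite big1 // => j _; apply: (etrans (delta2_tens _ _ _)).
have jk : (j <= k)%N by rewrite -ltnS.
rewrite !delta_large ?size_nseq ?ltn_sub2r ?(leq_ltn_trans jk) //.
by rewrite linear0 tens0l addr0.
Qed.

Definition Delta_ge1_basis (s : composition) : calH2 :=
  Delta_rec 0 s (Delta_ones (size s)).

Lemma Delta_ge1_exists : exists Delta : {linear calH -> calH2}, is_Delta_ge1 Delta.
Proof.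
pose D : {linear calH -> calH2} := linext Delta_ge1_basis.
have D_ones k : D << ones k >> = Delta_ones k.
  rewrite /= linextU /Delta_ge1_basis size_nseq.
  have aux l i x : Delta_rec i (ones l) x = x.
    by elim: l i => //= l IH i; rewrite IH invr1 scale1r.
  exact: aux.
exists D; split => //.
  by rewrite -[unitH]/(<< ones 0 >>) D_ones /Delta_ones big_ord1.
move=> i u i_gt0; rewrite -delta2E.
apply: (malg_linear_ext (f := delta2 i \o D) (g := D \o delta i)) u => s /=.
rewrite [in LHS]linextU; case: (leqP i (size s)) => is_; last first.
  rewrite delta_large // (linear0 D).
  apply: (etrans (Delta_rec_comm (f := delta2 i) _ _ _ _)) => [m x|].
    exact: delta2_comm.
  apply: (etrans (congr1 (Delta_rec 0 s) (delta2_ones is_))).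
  rewrite -[in LHS](scale0r (Delta_ones (size s))).
  apply: (etrans (esym (Delta_rec_comm (f := *:%R 0) _ _ _ _))) => [m x|].
    by apply: esym; exact: linearZ.
  exact: scale0r.
rewrite delta_small //; apply: (etrans _ (esym (raddf_sum D _ _ _))).
transitivity (\sum_(j < i) delta2_diff j (Delta_ge1_basis s)).
  rewrite -(big_mkord xpredT (fun j => delta2_diff j (Delta_ge1_basis s))).
  by rewrite telescope_sumr // delta2_0 subr0.
apply: eq_bigr => j _; have js : (j < size s)%N by apply: leq_trans is_.
apply: (etrans _ (esym (linearZ _ _))); rewrite /= linextU /Delta_ge1_basis.
by rewrite size_raise // Delta_rec_raise.
Qed.

Lemma weight_raise j t : (j < size t)%N -> weight (raise j t) = (weight t).+1.
Proof.
rewrite /weight /raise; elim: t j => // a t IH [_|j jt] /=.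
  by rewrite addn1 addSn.
by rewrite IH // addnS.
Qed.

Lemma Delta_ge1_unique (D1 D2 : {linear calH -> calH2}) :
  is_Delta_ge1 D1 -> is_Delta_ge1 D2 -> D1 =1 D2.
Proof.
move=> [_ D1o D1d] [_ D2o D2d]; apply: malg_linear_ext => s.
have [n] := ubnP (weight s); elim: n s => // n IH s ws.
have [/allP s1|/allPn[a /(nthP lone)[j js <-{a}]]] :=
  boolP (all (pred1 lone) s).
  have -> : s = ones (size s) by apply/all_pred1P/allP.
  by rewrite D1o D2o.
rewrite /= => aj.
have [n' val_aj] : exists n', val (nth lone s j) = n'.+2.
  move: aj; rewrite -val_eqE /=; case: (nth lone s j) => -[|[|m]] //= _ _.
  by exists m.
pose t : composition := set_nth lone s j (exist _ n'.+1 isT).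
have st : s = raise j t.
  rewrite /raise /t nth_set_nth /= eqxx set_set_nth eqxx.
  apply: (@eq_from_nth _ lone); first by rewrite size_set_nth; apply/esym/maxn_idPr.
  move=> l ls; rewrite nth_set_nth /=; case: eqP => // ->.
  by apply: val_inj; rewrite /= val_aj addn1.
have size_t : size t = size s by rewrite size_set_nth; apply/maxn_idPr.
have jt : (j < size t)%N by rewrite size_t.
have wt : (weight t < n)%N.
  by move: ws; rewrite st weight_raise.
have delta_s : n'.+1%:R *: << s >> = delta j.+1 << t >> - delta j << t >>.
  rewrite !delta_small //; last exact: ltnW.
  by rewrite big_ord_recr /= addrAC subrr add0r nth_set_nth /= eqxx -st.
apply: (@GRing.scalerI _ _ (n'.+1%:R : rat)).
  by rewrite (Num.Theory.pnatr_eq0 rat).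
have Dd (D : {linear calH -> calH2}) i :
    (forall i u, (1 <= i)%N -> id_circS_delta i (D u)
       + tens_map (delta i) id (D u) = D (delta i u)) ->
    D (delta i << t >>) = delta2 i (D << t >>).
  by case: i => [|i] H; rewrite ?delta0 ?delta2_0 ?linear0 // delta2E H.
have sc (D : {linear calH -> calH2}) :
    n'.+1%:R *: D << s >> = D (delta j.+1 << t >>) - D (delta j << t >>).
  by apply: (etrans (esym (linearZ _ _))); rewrite delta_s; apply: raddfB.
have e i : D1 (delta i << t >>) = D2 (delta i << t >>).
  apply: (etrans (Dd D1 i D1d)); rewrite (IH _ wt).
  exact: (esym (Dd D2 i D2d)).
apply: (etrans (sc D1)); apply: (etrans _ (esym (sc D2))).
exact: (congr2 (fun u v => u - v) (e j.+1) (e j)).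
Qed.

(* Main.v *)
Require Import Defs.
From HB Require Import structures.
From mathcomp Require Import all_boot all_order all_algebra.
From mathcomp Require Import finmap monalg.
From mathcomp Require Import zify.

Set Implicit Arguments.
Unset Strict Implicit.
Unset Printing Implicit Defensive.

Import GRing.Theory.
Local Open Scope ring_scope.

(** Both Hopf algebras are disguises of one object, the shuffle Hopf algebra on
the alphabet of positive integers (letter shuffle as product, deconcatenation
as coproduct), and the isomorphism passes through it.

Left-hand side.  Collect the basis in G_k(z_1, ..., z_k), the sum over s of
[s] z_1^(s_1 - 1) ... z_k^(s_k - 1).  Since Delta_ge1 intertwines the
derivations delta_i with explicit operators on the tensor square, it maps
G_k(z) to the sum over j of
  G_j(z_1 - z_(j+1), ..., z_j - z_(j+1)) tensor G_(k-j)(z_(j+1), ..., z_k).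
The substitution z_i = y_i + ... + y_k makes the shifts disappear: the series
F_k(y) = G_k(y_1 + ... + y_k, ..., y_k) is deconcatenated.  Its coefficients
are the elements
  brace s = (prod_j delta_j^(s_j - 1) / (s_j - 1)!) [1_k],
so that delta_j (brace s) = s_j brace (s + e_j), and [Delta_brace] is a
consequence of the defining equations of the coproduct alone.  The same
substitution turns the shuffle of words in x_0, x_1 into the
shuffle of the letters s_i ([shb_brace]): as a series in words,
  F_k(y) = x_1 F_(k-1)(y_2, ..., y_k) + (y_1 + ... + y_k) x_0 F_k(y),
and comparing this recursion with the recursive definition of the shuffle
gives the product formula by induction on the weight.  The elements brace s
form a basis because brace s - [s] only involves compositions of smaller
moment ([brace_triangular]).

Right-hand side.  A multiplicative functional c on the letter shuffle algebra
induces the map sending a word s to the sum, over all ways to cut s into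
nonempty consecutive blocks b_1 ... b_m, of c(b_1) ... c(b_m) [|b_1|, ..., |b_m|],
where |b| is the weight.  It respects deconcatenation because cutting is
coassociative, and it maps the shuffle to the quasi-shuffle because the first
block of a shuffle of u and v comes from u, from v, or from both, which are
the three terms of the quasi-shuffle recursion ([stuffle_block_sum]).  Its
matrix is triangular for the length, with diagonal entries prod_i c([s_i]).

The functional chi_0 is a character since words u and v have binomial(|u|+|v|, |u|)
shuffles, all of length |u|+|v|.  For c(s) = chi_0(brace s) the diagonal
entries are prod_i 1/s_i!, hence nonzero, and Psi: brace s |-> block_sum s is
an isomorphism.  It is the only graded morphism compatible with the
characters: the coefficient of a :: t in the image of brace s is that of
[a] tensor t in its deconcatenation, which is computed from shorter words and
from the prescribed character ([Psi_unique]). *)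

(** * Linear maps between free modules *)

(** A sealed copy of the basis vector: unification that fails on two basis vectors
would otherwise unfold their finitely supported functions. *)
HB.lock Definition bvec (K : choiceType) (k : K) : {malg rat[K]} := << k >>.

Lemma bvecE (K : choiceType) (k : K) : bvec k = << k >>.
Proof. by rewrite bvec.unlock. Qed.

Lemma mcoeff_bvec (K : choiceType) (k l : K) : (bvec k)@_l = (k == l)%:R.
Proof. by rewrite bvecE mcoeffU. Qed.

Lemma linext_bvec (K : choiceType) (V : lmodType rat) (f : K -> V) k :
  linext f (bvec k) = f k.
Proof. by rewrite bvecE linextU. Qed.

Lemma linear_ext (K : choiceType) (V : lmodType rat)
    (f g : {linear {malg rat[K]} -> V}) :
  (forall k, f (bvec k) = g (bvec k)) -> f =1 g.
Proof. by move=> fg; apply: malg_linear_ext => k; rewrite -bvecE. Qed.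

Lemma bilinext_bvec (K L : choiceType) (V : lmodType rat) (f : K -> L -> V) k l :
  bilinext f (bvec k) (bvec l) = f k l.
Proof. by rewrite !bvecE bilinextU. Qed.

Section FreeModule.

Variables (K L : choiceType) (V : lmodType rat).

Lemma linextE (f : {linear {malg rat[K]} -> V}) u :
  f u = linext (fun k => f (bvec k)) u.
Proof.
by apply: (linear_ext (g := linext (fun k => f (bvec k)))) => k /=; rewrite linext_bvec.
Qed.

Lemma linear_ext_supp (f g : {linear {malg rat[K]} -> V}) u :
  {in msupp u, forall k, f (bvec k) = g (bvec k)} -> f u = g u.
Proof.
move=> fg; rewrite (linextE f) (linextE g) /linext.
by apply: eq_big_seq => k /fg ->.
Qed.

Definition bilinextl (W : lmodType rat) (f : K -> L -> W) v u :=
  bilinext f u v.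

HB.instance Definition _ (W : lmodType rat) (f : K -> L -> W) v :=
  GRing.Linear.copy (bilinextl f v) (linext (fun k => linext (f k) v)).

Lemma bilinext_suml (f : K -> L -> V) (I : Type) (r : seq I) F v :
  bilinext f (\sum_(i <- r) F i) v = \sum_(i <- r) bilinext f (F i) v.
Proof. exact: (linear_sum (bilinextl f v)). Qed.

Lemma bilinext_sumr (f : K -> L -> V) (I : Type) (r : seq I) F u :
  bilinext f u (\sum_(i <- r) F i) = \sum_(i <- r) bilinext f u (F i).
Proof. exact: (linear_sum (bilinext f u)). Qed.

Lemma bilinextDl (f : K -> L -> V) u u' v :
  bilinext f (u + u') v = bilinext f u v + bilinext f u' v.
Proof. exact: (linearD (bilinextl f v)). Qed.

Lemma bilinextDr (f : K -> L -> V) u v v' :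
  bilinext f u (v + v') = bilinext f u v + bilinext f u v'.
Proof. exact: (linearD (bilinext f u)). Qed.

Lemma bilinextZl (f : K -> L -> V) c u v :
  bilinext f (c *: u) v = c *: bilinext f u v.
Proof. exact: (linearZZ (bilinextl f v)). Qed.

Lemma bilinextZr (f : K -> L -> V) c u v :
  bilinext f u (c *: v) = c *: bilinext f u v.
Proof. exact: (linearZZ (bilinext f u)). Qed.

Lemma bilinear_ext (f g : {malg rat[K]} -> {malg rat[L]} -> V) :
    (forall u, linear (f u)) -> (forall v, linear (f^~ v)) ->
    (forall u, linear (g u)) -> (forall v, linear (g^~ v)) ->
    (forall k l, f (bvec k) (bvec l) = g (bvec k) (bvec l)) ->
  forall u v, f u v = g u v.
Proof.
move=> fr fl gr gl fg u v.
pose pack (M : choiceType) (h : {malg rat[M]} -> V) (hl : linear h) :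
  {linear {malg rat[M]} -> V} := HB.pack h (GRing.isLinear.Build _ _ _ _ h hl).
apply: (linear_ext (f := pack _ _ (fl v)) (g := pack _ _ (gl v))) => k /=.
apply: (linear_ext (f := pack _ _ (fr (bvec k))) (g := pack _ _ (gr (bvec k)))) => l /=.
exact: fg.
Qed.

End FreeModule.

Section Support.

Variable K : choiceType.
Implicit Types (P Q : K -> Prop) (u v : {malg rat[K]}).

(** [homogeneous n] is the instance [weight s = n]. *)
Definition supported P u := {in msupp u, forall k, P k}.

Lemma supportedW P Q u : (forall k, P k -> Q k) -> supported P u -> supported Q u.
Proof. by move=> PQ Pu k /Pu /PQ. Qed.

Lemma supported0 P : supported P 0.
Proof. by move=> k; rewrite msupp0 inE. Qed.

Lemma supportedU P k : P k -> supported P (bvec k).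
Proof. by move=> Pk l; rewrite bvecE msuppU oner_eq0 inE => /eqP ->. Qed.

Lemma supportedD P u v : supported P u -> supported P v -> supported P (u + v).
Proof.
by move=> Pu Pv k /(fsubsetP (msuppD_le _ _)); rewrite inE => /orP[/Pu|/Pv].
Qed.

Lemma supportedZ P c u : supported P u -> supported P (c *: u).
Proof. by move=> Pu k /(fsubsetP (msuppZ_le _ _)) /Pu. Qed.

Lemma supported_unscale P c u : c != 0 -> supported P (c *: u) -> supported P u.
Proof. by move=> c0; rewrite /supported msuppZ (negPf c0). Qed.

Lemma supported_sum P (I : eqType) (r : seq I) (F : I -> {malg rat[K]}) :
  {in r, forall i, supported P (F i)} -> supported P (\sum_(i <- r) F i).
Proof.
move=> PF; rewrite big_seq; elim/big_rec: _ => [|i u ri Pu].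
  exact: supported0.
exact: supportedD (PF i ri) Pu.
Qed.

Lemma supported_linext (M : choiceType) P (f : M -> {malg rat[K]}) w :
  {in msupp w, forall k, supported P (f k)} -> supported P (linext f w).
Proof. by move=> Pf; apply: supported_sum => k kw; apply: supportedZ; apply: Pf kw. Qed.

Lemma supported_lin (M : choiceType) P
    (f : {linear {malg rat[M]} -> {malg rat[K]}}) w :
  {in msupp w, forall k, supported P (f (bvec k))} -> supported P (f w).
Proof. by rewrite linextE; apply: supported_linext. Qed.

End Support.

Section Triangular.

Variables (K : choiceType) (m : K -> nat) (c : K -> rat).
Variable f : {linear {malg rat[K]} -> {malg rat[K]}}.
Hypothesis c_neq0 : forall k, c k != 0.
Hypothesis f_tri :
  forall k, supported (fun l => (m l < m k)%N) (f (bvec k) - c k *: bvec k).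

Lemma supported_bounded (u : {malg rat[K]}) :
  exists n, supported (fun k => (m k < n)%N) u.
Proof.
exists (\max_(k <- msupp u) m k).+1 => k ku.
by rewrite ltnS (leq_bigmax_seq (F := m)).
Qed.

Let diag := linext (fun k => c k *: bvec k : {malg rat[K]}).
Let rest := linext (fun k => f (bvec k) - c k *: bvec k).

Let f_split u : f u = diag u + rest u.
Proof.
rewrite (linextE f) /diag /rest /linext -big_split /=; apply: eq_bigr => k _.
by rewrite -scalerDr addrCA subrr addr0.
Qed.

Let restP n u : supported (fun k => (m k < n.+1)%N) u ->
  supported (fun k => (m k < n)%N) (rest u).
Proof.
move=> un; apply: supported_linext => k /un mk.
by apply: (supportedW _ (@f_tri k)) => l /leq_trans; apply.
Qed.

Let diagE u k : (diag u)@_k = c k * u@_k.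
Proof.
rewrite /diag /linext raddf_sum /=.
under eq_bigr => l _ do rewrite !mcoeffZ mcoeff_bvec.
have [ku|ku] := boolP (k \in msupp u).
  rewrite (big_fsetD1 k) //= eqxx mulr1 mulrC big_seq big1 ?addr0 // => l.
  by rewrite !inE => /andP[/negPf -> _]; rewrite !mulr0.
rewrite (mcoeff_outdom ku) mulr0 big_seq big1 // => l lu.
by case: eqP ku => [<-|]; rewrite ?lu // !mulr0.
Qed.

(** Split f as its diagonal plus a rest that lowers the filtration by [m].  At an
index of top level only the diagonal contributes to [f u], so the coefficients
of a kernel element vanish level by level. *)
Lemma triangular_inj : injective f.
Proof.
apply: raddf_inj => u fu0.
have [n un] := supported_bounded u; elim: n u fu0 un => [|n IH] u fu0 un.
  apply/malgP => k; rewrite mcoeff0; apply: mcoeff_outdom.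
  by apply/negP => /un.
apply: IH => // k ku; have := un k ku; rewrite ltnS leq_eqVlt => /orP[/eqP mk|//].
move/malgP/(_ k): (f_split u); rewrite fu0 mcoeff0 mcoeffD diagE.
rewrite [(rest u)@_k]mcoeff_outdom; last first.
  by apply/negP => /(restP un); rewrite mk ltnn.
move/esym/eqP; rewrite addr0 mulf_eq0 (negPf (c_neq0 k)) mcoeff_eq0 /=.
by rewrite ku.
Qed.

(** Inverting the diagonal solves the equation up to an error one level lower. *)
Lemma triangular_surj v : exists u, f u = v.
Proof.
have [n vn] := supported_bounded v; elim: n v vn => [|n IH] v vn.
  exists 0; rewrite linear0; apply/malgP => k; rewrite mcoeff0.
  by apply/esym/mcoeff_outdom/negP => /vn.
pose u0 := linext (fun k => (c k)^-1 *: bvec k : {malg rat[K]}) v.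
have du0 : diag u0 = v.
  apply: (linear_ext (f := diag \o linext _) (g := idfun)) => k /=.
  by rewrite linext_bvec [LHS]linearZ /= /diag linext_bvec scalerA mulVf ?scale1r.
have u0n : supported (fun k => (m k < n.+1)%N) u0.
  by apply: supported_linext => k /vn mk; apply: supportedZ; exact: supportedU.
have restn : supported (fun k => (m k < n)%N) (- rest u0).
  by move=> k; rewrite msuppN => /(restP u0n).
have [u1 fu1] := IH _ restn.
by exists (u0 + u1); rewrite linearD fu1 f_split du0 addrK.
Qed.

Lemma triangular_bij : bijective f.
Proof.
have surj v : exists u, f u == v by have [u <-] := triangular_surj v; exists u.
have gK v : f (xchoose (surj v)) = v by apply/eqP/(xchooseP (surj v)).
by exists (fun v => xchoose (surj v)) => // u; apply: triangular_inj.
Qed.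

End Triangular.

(** * The basis that turns the coproduct into deconcatenation *)

(** Compositions are generated from those with all parts 1 by raising one part.
Whatever commutes with the derivations delta is therefore determined by its
values on the words [1, ..., 1]. *)
Lemma composition_raise_ind (P : composition -> Prop) :
    (forall k, P (ones k)) ->
    (forall j s, (j < size s)%N -> P s -> P (raise j s)) ->
  forall s, P s.
Proof.
move=> P1 Pr s; have [n] := ubnP (weight s); elim: n s => // n IH s ws.
have [s1|/allPn[a /(nthP lone)[j js <-{a}]]] := boolP (all (pred1 lone) s).
  by have -> : s = ones (size s) by apply/all_pred1P.
rewrite /= => aj.
have [n' val_aj] : exists n', val (nth lone s j) = n'.+2.
  move: aj; rewrite -val_eqE /=; case: (nth lone s j) => -[|[|m]] //= _ _.
  by exists m.
pose t : composition := set_nth lone s j (exist _ n'.+1 isT).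
have st : s = raise j t.
  rewrite /raise /t nth_set_nth /= eqxx set_set_nth eqxx.
  apply: (@eq_from_nth _ lone); first by rewrite size_set_nth; apply/esym/maxn_idPr.
  move=> l ls; rewrite nth_set_nth /=; case: eqP => // ->.
  by apply: val_inj; rewrite /= val_aj addn1.
have jt : (j < size t)%N by rewrite size_set_nth; apply: leq_trans (leq_maxr _ _).
rewrite st; apply: Pr => //; apply: IH.
by move: ws; rewrite st weight_raise.
Qed.

Lemma letter_neq0 (a : letter) : (val a)%:R != 0 :> rat.
Proof. by rewrite Num.Theory.pnatr_eq0 -lt0n (valP a). Qed.

Lemma delta_bvec i s : (i <= size s)%N ->
  delta i (bvec s) = \sum_(j < i) (val (nth lone s j))%:R *: bvec (raise j s).
Proof.
rewrite bvecE => /delta_small ->; apply: eq_bigr => j _; by rewrite bvecE.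
Qed.

Lemma delta_bvec0 i s : (size s < i)%N -> delta i (bvec s) = 0.
Proof. by rewrite bvecE => /delta_large. Qed.

Fixpoint brace_rec (i : nat) (s : composition) (x : calH) : calH :=
  if s is a :: s' then
    ((val a).-1`!)%:R^-1 *: iter (val a).-1 (delta i) (brace_rec i.+1 s' x)
  else x.

(** The coefficients of the generating series after z_i = y_i + ... + y_k:
since z_1 D_1 + ... + z_k D_k with D_i = delta_i - delta_(i-1) becomes
y_1 delta_1 + ... + y_k delta_k, the exponential series of the commuting
operators delta_i replaces that of the D_i, which produces the [s]. *)
Definition brace (s : composition) : calH := brace_rec 1 s (bvec (ones (size s))).

Lemma delta_commute i m u : delta i (delta m u) = delta m (delta i u).
Proof.
apply: (linear_ext (f := delta i \o delta m) (g := delta m \o delta i)) => s.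
by rewrite /= bvecE delta_comm.
Qed.

Lemma brace_rec_raise i j s x : (j < size s)%N ->
  (val (nth lone s j))%:R *: brace_rec i (raise j s) x
  = delta (i + j) (brace_rec i s x).
Proof.
elim: s i j => // a s IH i [_ |j js]; rewrite /raise /=.
  rewrite addn0 addn1; case: a => -[//|n] ? /=.
  rewrite [RHS]linearZ /= scalerA factS natrM invfM mulrA divff ?mul1r //.
  by rewrite Num.Theory.pnatr_eq0.
rewrite [RHS]linearZ /= scalerA mulrC -scalerA addnS -addSn; congr (_ *: _).
rewrite (iter_comm (f := delta _)) => [|y]; last exact: delta_commute.
rewrite -(IH i.+1 j js) [LHS](iter_comm (f := *:%R _)) => // y.
by rewrite [RHS]linearZ.
Qed.

(** In the braces the derivation delta_(j+1) is diagonal up to raising: it only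
touches part j, instead of the parts 0, ..., j. *)
Lemma brace_raise j s : (j < size s)%N ->
  (val (nth lone s j))%:R *: brace (raise j s) = delta j.+1 (brace s).
Proof.
by move=> js; rewrite /brace size_raise // brace_rec_raise.
Qed.

Lemma brace_ones k : brace (ones k) = bvec (ones k).
Proof.
rewrite /brace size_nseq.
suff aux l i x : brace_rec i (ones l) x = x by exact: aux.
by elim: l i => //= l IH i; rewrite IH invr1 scale1r.
Qed.

(** The sum of j * s_j over the positions j counted from 0.  The derivation
delta_(j+1) spreads one unit over the positions 0, ..., j, and the moment
measures how far to the right it lands. *)
Fixpoint moment (s : composition) : nat :=
  if s is a :: s' then (moment s' + weight s')%N else 0%N.

Lemma moment_raise j s : (j < size s)%N -> moment (raise j s) = (moment s + j)%N.
Proof.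
rewrite /raise; elim: s j => // a s IH [_|j js] /=; first by rewrite addn0.
rewrite IH // -[set_nth _ _ _ _]/(raise j s) weight_raise //; lia.
Qed.

Definition moment_below (s t : composition) : Prop :=
  [/\ size t = size s, weight t = weight s & (moment t < moment s)%N].

(** The word [t] raised at positions at most i gains at most i in moment, while
[s] raised at i gains exactly i. *)
Lemma delta_moment_below i s t : (i < size s)%N -> moment_below s t ->
  supported (moment_below (raise i s)) (delta i.+1 (bvec t)).
Proof.
move=> is_ [st wt mt]; rewrite delta_bvec ?st //.
apply: supported_sum => j _; apply: supportedZ; apply: supportedU.
have jt : (j < size t)%N by rewrite st (leq_trans (ltn_ord j)).
rewrite /moment_below !size_raise // !weight_raise // st wt; split=> //.
by rewrite !moment_raise // -addSn leq_add // -ltnS.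
Qed.

(** Induction along raisings: delta_(i+1) applied to [s] has the leading term
raise i s, all its other terms raise an earlier part. *)
Lemma brace_triangular s : supported (moment_below s) (brace s - bvec s).
Proof.
elim/composition_raise_ind: s => [k|i s is_ IH].
  by rewrite brace_ones subrr; apply: supported0.
apply: (@supported_unscale _ _ _ _ (letter_neq0 (nth lone s i))).
rewrite scalerBr brace_raise // -[brace s](subrK (bvec s)) [delta _ _]linearD /=.
rewrite -addrA; apply: supportedD.
  by apply: supported_lin => t /IH; apply: delta_moment_below.
rewrite delta_bvec // big_ord_recr /= addrK.
apply: supported_sum => j _; apply: supportedZ; apply: supportedU.
have js : (j < size s)%N by apply: ltn_trans is_.
rewrite /moment_below !size_raise // !weight_raise //; split=> //.
by rewrite !moment_raise // ltn_add2l.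
Qed.

Lemma brace_shape s :
  supported (fun t => size t = size s /\ weight t = weight s) (brace s).
Proof.
rewrite -[brace s](subrK (bvec s)); apply: supportedD; last exact: supportedU.
by apply: (supportedW _ (@brace_triangular s)) => t [].
Qed.

Definition brace_lin : calH -> calH := linext brace.
HB.instance Definition _ := GRing.Linear.on brace_lin.

Lemma brace_linU s : brace_lin (bvec s) = brace s.
Proof. exact: linext_bvec. Qed.

Lemma brace_lin_bij : bijective brace_lin.
Proof.
apply: (@triangular_bij _ moment (fun=> 1) brace_lin) => [s|s]; first exact: oner_neq0.
rewrite /= brace_linU scale1r.
by apply: (supportedW _ (@brace_triangular s)) => t [].
Qed.

Lemma take_drop_raise l j s : (j < size s)%N -> (l <= size s)%N ->
  (take l (raise j s), drop l (raise j s)) =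
  if (j < l)%N then (raise j (take l s), drop l s)
  else (take l s, raise (j - l) (drop l s)).
Proof.
rewrite /raise; elim: s l j => [|a s IH] [|l] [|j] //= js ls.
rewrite ltnS subSS; have := IH l j js ls.
by case: ifP => _ [-> ->].
Qed.

Lemma tensZl c u v : tens (c *: u) v = c *: tens u v.
Proof. exact: bilinextZl. Qed.

Lemma tensZr c u v : tens u (c *: v) = c *: tens u v.
Proof. exact: bilinextZr. Qed.

Section Coproduct.

Variable Delta : {linear calH -> calH2}.
Hypothesis HDelta : is_Delta_ge1 Delta.

Lemma Delta_delta i u : Delta (delta i u) = delta2 i (Delta u).
Proof.
case: i => [|i]; first by rewrite delta0 delta2_0 linear0.
by rewrite delta2E (Delta_ge1_delta HDelta).
Qed.

(** On a tensor with left factor of depth n, delta_i acts on the left when i is at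
most n and as delta_(i-n) on the right otherwise; the other summand is then 0. *)
Lemma delta2_tensE i n u v : supported (fun s => size s = n) u ->
  delta2 i (tens u v) = tens u (delta (i - n) v) + tens (delta i u) v.
Proof.
pose T (w : calH) : {linear calH -> calH2} := tensl w.
move=> un.
have := @linear_ext_supp _ _ (delta2 i \o T v)
  (T (delta (i - n) v) \+ (T v \o delta i)) u.
apply=> s /un <-; by rewrite /= bvecE; apply: delta2_tens.
Qed.

(** Induction along raisings: on each cut of s, delta_(j+1) only acts on the factor
that contains position j, where it raises that part and multiplies by it,
exactly as it does on brace s. *)
Lemma Delta_brace s :
  Delta (brace s)
  = \sum_(l < (size s).+1) tens (brace (take l s)) (brace (drop l s)).
Proof.
elim/composition_raise_ind: s => [k|j s js IH].
  rewrite brace_ones bvecE (Delta_ge1_ones HDelta) size_nseq; apply: eq_bigr => l _.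
  have lk : (l <= k)%N by rewrite -ltnS.
  have -> : take l (ones k) = ones l by exact: take_nseq.
  have -> : drop l (ones k) = ones (k - l) by exact: drop_nseq.
  by rewrite !brace_ones !bvecE.
apply: (scalerI (letter_neq0 (nth lone s j))).
rewrite -[LHS]linearZ /= brace_raise // Delta_delta IH linear_sum size_raise //.
rewrite scaler_sumr; apply: eq_bigr => l _.
have ls : (l <= size s)%N by rewrite -ltnS.
have [sz_t sz_d] : size (take l s) = l /\ size (drop l s) = (size s - l)%N.
  by rewrite size_takel // size_drop.
rewrite [LHS](@delta2_tensE _ l); last first.
  by apply: (supportedW _ (@brace_shape _)) => t []; rewrite sz_t.
have := take_drop_raise js ls; case: (ltnP j l) => jl [-> ->].
  have -> : (j.+1 - l = 0)%N by apply/eqP; rewrite subn_eq0.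
  rewrite delta0 linear0 add0r -brace_raise ?sz_t // tensZl.
  by rewrite nth_take.
have {1}-> : delta j.+1 (brace (take l s)) = 0.
  apply: (@linear_ext_supp _ _ (delta j.+1) \0) => t /(@brace_shape _) [st _].
  by rewrite /= delta_bvec0 // st sz_t ltnS.
rewrite tens0l addr0 subSn // -brace_raise ?sz_d ?ltn_sub2r ?(leq_ltn_trans jl) //.
by rewrite tensZr nth_drop subnKC.
Qed.

End Coproduct.

(** * A recursion on the first letter *)

Definition prepend (T : choiceType) (a : T) : {malg rat[seq T]} -> {malg rat[seq T]} :=
  linext (fun s => bvec (a :: s)).
HB.instance Definition _ (T : choiceType) (a : T) := GRing.Linear.on (prepend a).

Lemma prependU (T : choiceType) (a : T) s : prepend a (bvec s) = bvec (a :: s).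
Proof. exact: linext_bvec. Qed.

Definition raise_head : calH -> calH := linext (fun s => bvec (raise 0 s)).
HB.instance Definition _ := GRing.Linear.on raise_head.

Lemma raise_headU s : raise_head (bvec s) = bvec (raise 0 s).
Proof. exact: linext_bvec. Qed.

Lemma delta_cons i a s : (i <= size s)%N ->
  delta i.+1 (bvec (a :: s))
  = (val a)%:R *: bvec (ladd a lone :: s) + prepend a (delta i (bvec s)).
Proof.
move=> is_; rewrite delta_bvec // big_ord_recl; congr (_ + _).
rewrite delta_bvec // [RHS]linear_sum; apply: eq_bigr => j _ /=.
by rewrite linearZ /= prependU.
Qed.

(** Leibniz rule for the letter x_1 at the head: delta_(i+1) turns it into
x_0 x_1, and the parts behind it are counted from one place further. *)
Lemma delta_prepend i n u : supported (fun s => size s = n) u -> (i <= n)%N ->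
  delta i.+1 (prepend lone u) = raise_head (prepend lone u) + prepend lone (delta i u).
Proof.
move=> un i_n.
apply: (@linear_ext_supp _ _ (delta i.+1 \o prepend lone)
  ((raise_head \o prepend lone) \+ (prepend lone \o delta i))) => s /un ss /=.
by rewrite prependU raise_headU delta_cons ?ss // scale1r.
Qed.

(** Leibniz rule for a letter x_0 at the head: it becomes x_0 x_0. *)
Lemma delta_raise_head i n u : supported (fun s => size s = n) u -> (i < n)%N ->
  delta i.+1 (raise_head u)
  = raise_head (delta i.+1 u) + raise_head (raise_head u).
Proof.
move=> un i_n.
apply: (@linear_ext_supp _ _ (delta i.+1 \o raise_head)
  ((raise_head \o delta i.+1) \+ (raise_head \o raise_head))) => s /un ss /=.
case: s ss => [|a s] ss; first by rewrite -ss in i_n.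
have is_ : (i <= size s)%N by rewrite -ltnS; move: i_n; rewrite -ss.
have raise_prepend b u' : raise_head (prepend b u') = prepend (ladd b lone) u'.
  apply: (linear_ext (f := raise_head \o prepend b) (g := prepend (ladd b lone))).
  by move=> t /=; rewrite !prependU raise_headU.
have raise_cons b : raise_head (bvec (b :: s)) = bvec (ladd b lone :: s).
  exact: raise_headU.
rewrite raise_cons !(delta_cons _ is_) linearD linearZ /= raise_prepend.
rewrite !raise_cons addrAC; congr (_ + _).
by rewrite addn1 -natr1 scalerDl scale1r.
Qed.

(** A sequence, so that a part equal to 1, which cannot be lowered, contributes the
empty sum. *)
Definition lower1 (a : letter) : seq letter :=
  [seq b <- [:: insubd lone (val a).-1] | ladd b lone == a].

Fixpoint lowers (s : composition) : seq composition :=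
  if s is a :: s' then
    [seq b :: s' | b <- lower1 a] ++ [seq a :: t | t <- lowers s']
  else [::].

Lemma ladd_lone_neq a : (ladd a lone == lone) = false.
Proof. by case: a => -[|n] // n_gt0; apply/eqP => /(congr1 val); rewrite /= addn1. Qed.

Lemma lower1_lone : lower1 lone = [::].
Proof.
rewrite /lower1 /=; case: eqP => // /(congr1 val) /=.
by rewrite val_insubd.
Qed.

Lemma lower1_add a : lower1 (ladd a lone) = [:: a].
Proof.
suff eb : insubd lone (val (ladd a lone)).-1 = a by rewrite /lower1 eb /= eqxx.
by apply: val_inj; rewrite val_insubd /= addn1 /= (valP a).
Qed.

Lemma lower1_cases a : a = lone \/ exists b, a = ladd b lone.
Proof.
case: a => -[//|[|n]] n_gt0; [left|right]; first exact: val_inj.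
by exists (exist _ n.+1 isT); apply: val_inj; rewrite /= addn1.
Qed.

Lemma lowers_cons a s :
  lowers (a :: s) = [seq b :: s | b <- lower1 a] ++ [seq a :: t | t <- lowers s].
Proof. by []. Qed.

Lemma lowers_shape s t : t \in lowers s ->
  size t = size s /\ weight s = (weight t).+1.
Proof.
elim: s t => // a s IH t /=; rewrite mem_cat => /orP[] /mapP[b].
  rewrite mem_filter => /andP[/eqP <- _] ->; split=> //.
  by rewrite /weight /= addn1 addSn.
by move=> /IH[sb wb] ->; rewrite /= sb /weight /= [sumn _]wb addnS.
Qed.

(** Multiplication by y_1 + ... + y_k on generating series: its coefficient at s
is the sum of the coefficients at s - e_j. *)
Definition lower_lin : calH -> calH := linext (fun s => \sum_(t <- lowers s) bvec t).
HB.instance Definition _ := GRing.Linear.on lower_lin.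

Lemma lower_linU s : lower_lin (bvec s) = \sum_(t <- lowers s) bvec t.
Proof. exact: linext_bvec. Qed.

(** The operator that [delta i.+1] becomes in the basis of braces. *)
Definition raise_lin (i : nat) : calH -> calH :=
  linext (fun s => (val (nth lone s i))%:R *: bvec (raise i s)).
HB.instance Definition _ i := GRing.Linear.on (raise_lin i).

Lemma raise_linU i s : raise_lin i (bvec s) = (val (nth lone s i))%:R *: bvec (raise i s).
Proof. exact: linext_bvec. Qed.

Lemma delta_brace_lin i u : supported (fun s => (i < size s)%N) u ->
  delta i.+1 (brace_lin u) = brace_lin (raise_lin i u).
Proof.
move=> ui.
apply: (@linear_ext_supp _ _ (delta i.+1 \o brace_lin) (brace_lin \o raise_lin i)) => s /ui.
by move=> is_ /=; rewrite brace_linU raise_linU linearZ /= brace_linU brace_raise.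
Qed.

Lemma raise_lin0_prepend a u : raise_lin 0 (prepend a u) = (val a)%:R *: prepend (ladd a lone) u.
Proof.
apply: (linear_ext (f := raise_lin 0 \o prepend a)
  (g := (val a)%:R \*: prepend (ladd a lone))) => s /=.
by rewrite !prependU raise_linU.
Qed.

Lemma raise_linS_prepend i a u : raise_lin i.+1 (prepend a u) = prepend a (raise_lin i u).
Proof.
apply: (linear_ext (f := raise_lin i.+1 \o prepend a) (g := prepend a \o raise_lin i)) => s /=.
by rewrite prependU !raise_linU linearZ /= prependU.
Qed.

Lemma lower_lin_prepend a u :
  lower_lin (prepend a u) = \sum_(b <- lower1 a) prepend b u + prepend a (lower_lin u).
Proof.
case: (lower1_cases a) => [->|[b ->]].
  rewrite lower1_lone big_nil add0r.
  apply: (linear_ext (f := lower_lin \o prepend lone) (g := prepend lone \o lower_lin)) => s /=.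
  rewrite prependU !lower_linU lowers_cons lower1_lone /= big_map [RHS]linear_sum.
  by apply: eq_bigr => t _; rewrite /= prependU.
rewrite lower1_add big_seq1.
apply: (linear_ext (f := lower_lin \o prepend (ladd b lone))
  (g := prepend b \+ (prepend (ladd b lone) \o lower_lin))) => s /=.
rewrite !prependU !lower_linU lowers_cons lower1_add /= big_cons big_map; congr (_ + _).
by rewrite [RHS]linear_sum; apply: eq_bigr => t _; rewrite /= prependU.
Qed.

(** The Weyl relation of d/dy_i with multiplication by y_1 + ... + y_k. *)
Lemma lower_raise_commutator i s : (i < size s)%N ->
  lower_lin (raise_lin i (bvec s)) = raise_lin i (lower_lin (bvec s)) + bvec s.
Proof.
elim: s i => // a s IH [_|i is_]; rewrite -prependU.
  rewrite raise_lin0_prepend [lower_lin _]linearZ /= !lower_lin_prepend lower1_add big_seq1.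
  rewrite [raise_lin 0 _]linearD /= raise_lin0_prepend scalerDr addrAC; congr (_ + _).
  case: (lower1_cases a) => [->|[b ->]].
    by rewrite lower1_lone big_nil linear0 add0r scale1r.
  by rewrite lower1_add big_seq1 raise_lin0_prepend /= addn1 -natr1 scalerDl scale1r.
rewrite raise_linS_prepend !lower_lin_prepend (IH i is_) linearD.
rewrite [raise_lin i.+1 _]linearD /= raise_linS_prepend.
rewrite [raise_lin i.+1 _]linear_sum addrA /=.
by under [in RHS]eq_bigr => b _ do rewrite raise_linS_prepend.
Qed.

(** The coefficient of the series for the word without its first letter, viewed
as constant in the first variable: it vanishes unless the first part is 1. *)
Definition brace_head (s : composition) : calH :=
  if s is a :: s' then if a == lone then brace s' else 0 else 0.

(** The coefficient form of F_k(y) = x_1 F_(k-1)(y_2, ...) + (y_1 + ... + y_k) x_0 F_k(y).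
It is preserved by raising part i: apply delta_(i+1) with the two Leibniz rules.
The terms x_0 x_0 cancel against the commutator of raising and lowering, up to
x_0 times the first summand, which the rule for x_1 supplies. *)
Lemma brace_recursion s : s != [::] ->
  brace s = prepend lone (brace_head s) + raise_head (brace_lin (lower_lin (bvec s))).
Proof.
elim/composition_raise_ind: s => [[|k] //|i s is_ IH].
  move=> _; rewrite brace_ones /= brace_ones prependU.
  have low1 l : lowers (ones l) = [::] by elim: l => // l IHl; rewrite lowers_cons lower1_lone IHl.
  by rewrite lower_linU -[_ :: _]/(ones k.+1) low1 big_nil !linear0 addr0.
move=> _; have s0 : s != [::] by case: (s) is_.
apply: (scalerI (letter_neq0 (nth lone s i))).
rewrite brace_raise // {1}IH // linearD /=.
have lower_linS : supported (fun t => size t = size s) (lower_lin (bvec s)).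
  rewrite lower_linU; apply: supported_sum => t /lowers_shape[st _].
  exact: supportedU.
have brace_linS : supported (fun t => size t = size s) (brace_lin (lower_lin (bvec s))).
  apply: supported_lin => t /lower_linS st; rewrite /= brace_linU.
  by apply: (supportedW _ (@brace_shape t)) => r []; rewrite st.
rewrite (delta_raise_head brace_linS) // delta_brace_lin; last first.
  by apply: (supportedW _ lower_linS) => t ->.
have -> : raise_lin i (lower_lin (bvec s)) = lower_lin (raise_lin i (bvec s)) - bvec s.
  by rewrite lower_raise_commutator // addrK.
(* The first summand of the recursion reproduces itself up to x_0 x_1 A, which
   is the defect left by the commutator. *)
have head : delta i.+1 (prepend lone (brace_head s))
    = (val (nth lone s i))%:R *: prepend lone (brace_head (raise i s))
      + raise_head (prepend lone (brace_head s)).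
  case: s is_ {IH s0 lower_linS brace_linS} => // a s is_.
  have [a1|a1] := boolP (a == lone); last first.
    rewrite [brace_head (a :: s)]/= (negPf a1) !linear0 addr0.
    case: i is_ => [|i] is_; rewrite /raise /= ?(negPf a1) ?linear0 ?scaler0 //.
    by rewrite ladd_lone_neq linear0 scaler0.
  have bs : supported (fun t => size t = size s) (brace s).
    by apply: (supportedW _ (@brace_shape s)) => t [].
  rewrite [brace_head (a :: s)]/= a1 (delta_prepend bs is_) addrC; congr (_ + _).
  case: i is_ => [|i] is_; rewrite /raise /= ?a1.
    by rewrite delta0 linear0 ladd_lone_neq linear0 scaler0.
  by rewrite -brace_raise // linearZ.
rewrite {}head linearB /= brace_linU linearB /= raise_linU linearZ /= linearZ /= linearZ /=.
rewrite {1}(IH s0) linearD /= scalerDr.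
have cancel (V : zmodType) (p q r t : V) : p + q + (r - (q + t) + t) = p + r.
  by rewrite opprD -!addrA addNr addr0 [q + _]addrC subrK.
exact: cancel.
Qed.

(** * In the new basis the product is the shuffle of letters *)

Section Interleavings.

Variable T : Type.
Implicit Types (a b : T) (s t : seq T).

Fixpoint interleave s : seq T -> seq (seq T) :=
  fix interleave_s t :=
    match s, t with
    | [::], _ => [:: t]
    | _, [::] => [:: s]
    | a :: s', b :: t' =>
        map (cons a) (interleave s' t) ++ map (cons b) (interleave_s t')
    end.

Lemma interleave0s t : interleave [::] t = [:: t].
Proof. by case: t. Qed.

Lemma interleaves0 s : interleave s [::] = [:: s].
Proof. by case: s. Qed.

Lemma sum_interleave_cons (V : nmodType) (g : seq T -> V) a s b t :
  \sum_(r <- interleave (a :: s) (b :: t)) g r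
  = \sum_(r <- interleave s (b :: t)) g (a :: r)
    + \sum_(r <- interleave (a :: s) t) g (b :: r).
Proof. by rewrite /= big_cat !big_map. Qed.

End Interleavings.
Arguments interleave : simpl never.

Lemma interleave_weight (s t r : composition) :
  r \in interleave s t -> weight r = (weight s + weight t)%N.
Proof.
rewrite /weight; elim: s t r => [|a s IHs] t r.
  by rewrite interleave0s inE => /eqP ->.
elim: t r => [|b t IHt] r; first by rewrite inE => /eqP ->; rewrite addn0.
rewrite mem_cat => /orP[] /mapP[r' ].
  by move=> /IHs wr -> /=; rewrite wr addnA.
by move=> /IHt wr -> /=; rewrite wr /= addnCA.
Qed.

(** Lowering one part is a derivation of the letter shuffle, like every operator
that replaces one letter at a time. *)
Lemma lowers_interleave (V : nmodType) (g : composition -> V) s t :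
  \sum_(r <- interleave s t) \sum_(q <- lowers r) g q
  = \sum_(p <- lowers s) \sum_(r <- interleave p t) g r
    + \sum_(p <- lowers t) \sum_(r <- interleave s p) g r.
Proof.
elim: s t g => [|a s IHs] t g.
  rewrite interleave0s big_seq1 big_nil add0r; apply: eq_bigr => p _.
  by rewrite interleave0s big_seq1.
elim: t g => [|b t IHt] g.
  rewrite interleaves0 big_seq1 big_nil addr0; apply: eq_bigr => p _.
  by rewrite interleaves0 big_seq1.
rewrite sum_interleave_cons.
under eq_bigr => r _ do rewrite lowers_cons big_cat !big_map /=.
under [X in _ + X]eq_bigr => r _ do rewrite lowers_cons big_cat !big_map /=.
rewrite !big_split /= IHs IHt.
rewrite !lowers_cons !big_cat !big_map /=.
under [X in _ = X + _ + _]eq_bigr => x _ do rewrite sum_interleave_cons.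
under [X in _ = _ + X + _]eq_bigr => p _ do rewrite sum_interleave_cons.
under [X in _ = _ + (X + _)]eq_bigr => x _ do rewrite sum_interleave_cons.
under [X in _ = _ + (_ + X)]eq_bigr => p _ do rewrite sum_interleave_cons.
rewrite !big_split /=.
have swap (A B : Type) (ra : seq A) (rb : seq B) (F : A -> B -> V) :
    \sum_(x <- ra) \sum_(y <- rb) F x y = \sum_(y <- rb) \sum_(x <- ra) F x y.
  exact: exchange_big.
rewrite [X in X + _ + _ = _]swap [X in _ + (X + _) = _]swap.
by rewrite !addrA [LHS](ACl (1*6*2*7*3*5*4*8)).
Qed.

Lemma shuffle_bvec u v :
  shuffle (bvec u) (bvec v) = \sum_(w <- shuffles u v) bvec w.
Proof.
rewrite /shuffle bilinext_bvec; apply: eq_bigr => w _; by rewrite bvecE.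
Qed.

Lemma shuffle_nill y : shuffle (bvec [::]) y = y.
Proof.
apply: (linear_ext (f := bilinext _ (bvec [::])) (g := idfun)) => v /=.
by rewrite -/(shuffle _ _) shuffle_bvec; case: v => [|b v]; rewrite big_seq1.
Qed.

Lemma shuffle_nilr x : shuffle x (bvec [::]) = x.
Proof.
apply: (linear_ext (f := bilinextl _ (bvec [::])) (g := idfun)) => u /=.
by rewrite /bilinextl -/(shuffle _ _) shuffle_bvec; case: u => [|b u]; rewrite big_seq1.
Qed.

Lemma shuffle_prepend a b x y :
  shuffle (prepend a x) (prepend b y)
  = prepend a (shuffle x (prepend b y)) + prepend b (shuffle (prepend a x) y).
Proof.
pose F (u v : word) : {malg rat[word]} := \sum_(w <- shuffles u v) << w >>.
apply: (linear_ext (f := bilinextl F (prepend b y) \o prepend a)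
  (g := (prepend a \o bilinextl F (prepend b y))
        \+ (prepend b \o (bilinextl F y \o prepend a)))) => u {x} /=.
rewrite /bilinextl.
apply: (linear_ext (f := bilinext F (prepend a (bvec u)) \o prepend b)
  (g := (prepend a \o (bilinext F (bvec u) \o prepend b))
        \+ (prepend b \o bilinext F (prepend a (bvec u))))) => v {y} /=.
rewrite !prependU -!/(shuffle _ _) !shuffle_bvec /= big_cat !big_map /=.
rewrite ![prepend _ (\sum_(_ <- _) _)]linear_sum /=.
by congr (_ + _); apply: eq_bigr => w _; rewrite prependU.
Qed.

Lemma rho_bvec s : rho (bvec s) = bvec (rho_word s).
Proof. by rewrite /rho linext_bvec bvecE. Qed.

Lemma rhoK : cancel rho unrho.
Proof.
apply: (linear_ext (f := unrho \o rho) (g := idfun)) => s /=.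
by rewrite rho_bvec /unrho linext_bvec rho_wordK bvecE.
Qed.

Lemma rho_prepend u : rho (prepend lone u) = prepend true (rho u).
Proof.
apply: (linear_ext (f := rho \o prepend lone) (g := prepend true \o rho)) => s /=.
by rewrite prependU !rho_bvec prependU rho_word_cons.
Qed.

Lemma rho_raise_head u : supported (fun s => s != [::]) u ->
  rho (raise_head u) = prepend false (rho u).
Proof.
move=> u0; apply: (@linear_ext_supp _ _ (rho \o raise_head) (prepend false \o rho)).
move=> [|a s] /u0 // _ /=; rewrite raise_headU !rho_bvec prependU.
rewrite /raise /= !rho_word_cons /= addn1.
by case: a => -[].
Qed.

Definition brace_word s := rho (brace s).
Definition brace_word_head s := rho (brace_head s).
Definition brace_word_low s := \sum_(t <- lowers s) brace_word t.

Lemma brace_word_rec s : s != [::] ->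
  brace_word s = prepend true (brace_word_head s) + prepend false (brace_word_low s).
Proof.
move=> s0; rewrite /brace_word (brace_recursion s0) linearD /= rho_prepend.
congr (_ + _); rewrite lower_linU [brace_lin _]linear_sum rho_raise_head.
  congr (prepend _ _); rewrite [LHS]linear_sum; apply: eq_bigr => t _ /=.
  by rewrite brace_linU.
apply: supported_sum => t /lowers_shape[st _] /=; rewrite brace_linU.
apply: (supportedW _ (@brace_shape t)) => r [].
by rewrite st => sr _; rewrite -size_eq0 sr size_eq0.
Qed.

(** Both sides obey the same recursion on the first letter in x_0, x_1.  Expanding
each factor as x_1 A + x_0 B, the terms starting with x_1 are the shuffles in
which the first part of s or of t is used up, and the terms starting with x_0
are handled by the derivation property of lowering.  All the shuffles that
remain have smaller weight. *)
Lemma shuffle_brace_word s t :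
  shuffle (brace_word s) (brace_word t) = \sum_(r <- interleave s t) brace_word r.
Proof.
have [n] := ubnP (weight s + weight t)%N; elim: n s t => // n IH s t.
have W0 : brace_word [::] = bvec [::] by rewrite /brace_word (brace_ones 0) rho_bvec.
case: s => [|a s]; first by rewrite W0 shuffle_nill interleave0s big_seq1.
case: t => [|b t]; first by rewrite W0 shuffle_nilr interleaves0 big_seq1.
move=> wst.
have heads : shuffle (brace_word_head (a :: s)) (brace_word (b :: t))
    + shuffle (brace_word (a :: s)) (brace_word_head (b :: t))
    = \sum_(r <- interleave (a :: s) (b :: t)) brace_word_head r.
  rewrite sum_interleave_cons /brace_word_head /=.
  congr (_ + _).
    case: eqP => [ea|_]; last first.
      rewrite linear0 big1 //; apply: (linear0 (bilinextl _ _)).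
    apply: IH; move: wst; rewrite ea /weight /= !addnA; lia.
  case: eqP => [eb|_]; last first.
    rewrite linear0 big1 //; apply: (linear0 (bilinext _ _)).
  apply: IH; move: wst; rewrite eb /weight /=; lia.
have lows : shuffle (brace_word_low (a :: s)) (brace_word (b :: t))
    + shuffle (brace_word (a :: s)) (brace_word_low (b :: t))
    = \sum_(r <- interleave (a :: s) (b :: t)) brace_word_low r.
  rewrite lowers_interleave /shuffle bilinext_suml bilinext_sumr.
  congr (_ + _); apply: eq_big_seq => p /lowers_shape[_ wp]; apply: IH;
    by move: wst; rewrite wp ?addSn ?addnS ltnS.
transitivity (prepend true (\sum_(r <- interleave (a :: s) (b :: t)) brace_word_head r)
  + prepend false (\sum_(r <- interleave (a :: s) (b :: t)) brace_word_low r)); last first.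
  rewrite !linear_sum -big_split /=; apply: eq_big_seq => r /interleave_weight wr.
  by rewrite brace_word_rec //; apply/eqP => r0; move: wr (valP a); rewrite r0 /weight /=; lia.
rewrite -heads -lows.
have Wa := @brace_word_rec (a :: s) isT; have Wb := @brace_word_rec (b :: t) isT.
move: Wa Wb; move: (brace_word _) (brace_word _) => wb wa.
move: (brace_word_head _) (brace_word_head _) => hb ha.
move: (brace_word_low _) (brace_word_low _) => lb la Wa Wb.
rewrite Wa Wb /shuffle !(bilinextDl, bilinextDr) -/shuffle.
rewrite !shuffle_prepend.
have prependD c x y : prepend c (x + y) = prepend c x + prepend c y by exact: linearD.
have ac (V : nmodType) (x1 x2 x3 x4 x5 x6 x7 x8 : V) :
    x1 + x2 + (x3 + x4) + (x5 + x6 + (x7 + x8))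
    = x1 + x3 + (x2 + x6) + (x5 + x7 + (x4 + x8)).
  by rewrite !addrA [LHS](ACl (1*3*2*6*5*7*4*8)).
move: (shuffle ha (prepend true hb)) (shuffle ha (prepend false lb)) => x1 x3.
move: (shuffle la (prepend true hb)) (shuffle la (prepend false lb)) => x5 x7.
move: (shuffle (prepend true ha) hb) (shuffle (prepend true ha) lb) => x2 x4.
move: (shuffle (prepend false la) hb) (shuffle (prepend false la) lb) => x6 x8.
rewrite !prependD; exact: ac.
Qed.

Lemma shb_brace s t : shb (brace s) (brace t) = \sum_(r <- interleave s t) brace r.
Proof.
rewrite /shb -!/(brace_word _) shuffle_brace_word linear_sum.
by apply: eq_bigr => r _; apply: rhoK.
Qed.

(** * Cutting words in two *)

Section Splits.

Variable T : Type.
Implicit Types s t : seq T.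

Fixpoint splits s : seq (seq T * seq T) :=
  ([::], s) :: if s is a :: s' then [seq (a :: p.1, p.2) | p <- splits s'] else [::].

Definition nonnil_splits s := behead (splits s).

Lemma splitsE s : splits s = ([::], s) :: nonnil_splits s.
Proof. by case: s. Qed.

Lemma nonnil_splits_cons a s : nonnil_splits (a :: s) = [seq (a :: p.1, p.2) | p <- splits s].
Proof. by []. Qed.

Section Sums.

Variable V : nmodType.

Lemma sum_splits_cons (g : seq T * seq T -> V) a s :
  \sum_(p <- splits (a :: s)) g p
  = g ([::], a :: s) + \sum_(p <- splits s) g (a :: p.1, p.2).
Proof. by rewrite big_cons big_map. Qed.

Lemma sum_splits (g : seq T -> seq T -> V) s :
  \sum_(p <- splits s) g p.1 p.2 = \sum_(l < (size s).+1) g (take l s) (drop l s).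
Proof.
elim: s g => [|a s IH] g; first by rewrite big_seq1 big_ord1.
by rewrite sum_splits_cons big_ord_recl (IH (fun x => g (a :: x))).
Qed.

Lemma splits_coassoc (h : seq T -> seq T -> seq T -> V) s :
  \sum_(p <- splits s) \sum_(q <- splits p.2) h p.1 q.1 q.2
  = \sum_(p <- splits s) \sum_(q <- splits p.1) h q.1 q.2 p.2.
Proof.
elim: s h => [|a s IH] h; first by rewrite !big_seq1.
rewrite !sum_splits_cons /= (IH (fun x => h (a :: x))) big_seq1 -addrA; congr (_ + _).
by under [RHS]eq_bigr => p _ do rewrite sum_splits_cons /=; rewrite big_split.
Qed.

Lemma nonnil_splits_coassoc (h : seq T -> seq T -> seq T -> V) s :
  \sum_(p <- nonnil_splits s) \sum_(q <- splits p.2) h p.1 q.1 q.2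
  = \sum_(p <- nonnil_splits s) \sum_(q <- nonnil_splits p.1) h q.1 q.2 p.2.
Proof.
case: s => [|a s]; first by rewrite !big_nil.
rewrite !nonnil_splits_cons !big_map /=.
rewrite (splits_coassoc (fun x => h (a :: x))); apply: eq_bigr => p _.
by rewrite nonnil_splits_cons big_map.
Qed.

(** Deconcatenation is multiplicative for the letter shuffle. *)
Lemma splits_interleave (g : seq T -> seq T -> V) s t :
  \sum_(r <- interleave s t) \sum_(p <- splits r) g p.1 p.2
  = \sum_(p <- splits s) \sum_(q <- splits t)
      \sum_(x <- interleave p.1 q.1) \sum_(y <- interleave p.2 q.2) g x y.
Proof.
elim: s t g => [|a s IHs] t g.
  rewrite interleave0s !big_seq1; apply: eq_bigr => q _.
  by rewrite !interleave0s !big_seq1.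
elim: t g => [|b t IHt] g.
  rewrite interleaves0 big_seq1; apply: eq_bigr => p _.
  by rewrite big_seq1 !interleaves0 !big_seq1.
rewrite sum_interleave_cons.
under eq_bigr => r _ do rewrite sum_splits_cons /=.
under [X in _ + X]eq_bigr => r _ do rewrite sum_splits_cons /=.
rewrite !big_split /= (IHs _ (fun x => g (a :: x))) (IHt (fun x => g (b :: x))).
rewrite addrACA -(sum_interleave_cons (fun r => g [::] r)).
rewrite [RHS]sum_splits_cons /= !sum_splits_cons /=.
rewrite interleave0s !big_seq1 -!addrA; congr (_ + _).
under [X in _ = _ + X]eq_bigr => p _ do rewrite sum_splits_cons /=.
rewrite big_split /=.
under [X in _ = _ + (_ + X)]eq_bigr => p _ do
  under eq_bigr => q _ do rewrite sum_interleave_cons.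
under [X in _ = _ + (_ + X)]eq_bigr => p _ do rewrite big_split /=.
rewrite big_split /=.
under [X in X + _ = _]eq_bigr => p _ do rewrite sum_splits_cons /= interleaves0 big_seq1.
rewrite big_split /=.
have comm (x y z w : V) : x + y + (z + w) = z + (x + (y + w)).
  by rewrite addrCA !addrA.
rewrite comm; congr (_ + _); last congr (_ + _).
- by apply: eq_bigr => q _; rewrite !interleave0s !big_seq1.
- by apply: eq_bigr => q _; rewrite interleaves0 big_seq1.
Qed.

(** A nonempty prefix of a shuffle of s and t consists of letters of s only, of
letters of t only, or of letters of both: these are the three terms of the
quasi-shuffle recursion. *)
Lemma nonnil_splits_interleave (g : seq T -> seq T -> V) s t :
  \sum_(r <- interleave s t) \sum_(p <- nonnil_splits r) g p.1 p.2
  = \sum_(p <- nonnil_splits s) \sum_(y <- interleave p.2 t) g p.1 y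
    + \sum_(q <- nonnil_splits t) \sum_(y <- interleave s q.2) g q.1 y
    + \sum_(p <- nonnil_splits s) \sum_(q <- nonnil_splits t)
        \sum_(x <- interleave p.1 q.1) \sum_(y <- interleave p.2 q.2) g x y.
Proof.
(* Extended by zero to the cut with empty prefix, so that the formula for all
   cuts applies. *)
pose g' x y := if x is [::] then 0 else g x y.
have g'E r : \sum_(p <- nonnil_splits r) g p.1 p.2 = \sum_(p <- splits r) g' p.1 p.2.
  case: r => [|a r]; first by rewrite big_seq1 big_nil.
  by rewrite sum_splits_cons nonnil_splits_cons big_map add0r.
under eq_bigr => r _ do rewrite g'E.
rewrite splits_interleave.
case: s => [|a s].
  rewrite big_seq1 [nonnil_splits [::]]/= !big_nil add0r addr0 splitsE big_cons.
  rewrite interleave0s big_seq1 big1 // add0r.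
  case: t => [|b t]; first by rewrite !big_nil.
  rewrite !nonnil_splits_cons !big_map; apply: eq_bigr => q _.
  by rewrite !interleave0s !big_seq1.
case: t => [|b t].
  rewrite [nonnil_splits [::]]/= !big_nil addr0.
  under [X in _ = _ + X]eq_bigr => p _ do rewrite big_nil.
  rewrite big1_eq addr0 sum_splits_cons big_seq1 big_seq1 big1 // add0r.
  rewrite nonnil_splits_cons big_map; apply: eq_bigr => p _.
  by rewrite big_seq1 !interleaves0 !big_seq1.
rewrite !nonnil_splits_cons !big_map sum_splits_cons sum_splits_cons /=.
rewrite interleave0s big_seq1 [X in X + _ + _ = _]big1 // add0r addrC.
under eq_bigr => p _ do rewrite sum_splits_cons /= interleaves0 big_seq1.
rewrite big_split /= addrAC; congr (_ + _ + _).
- by apply: eq_bigr => q _; rewrite !interleave0s !big_seq1.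
- apply: eq_bigr => p _; rewrite big_map; apply: eq_bigr => q _.
  by rewrite !sum_interleave_cons.
Qed.

End Sums.

End Splits.
Arguments splits : simpl never.
Arguments nonnil_splits : simpl never.

(** * From the shuffle to the quasi-shuffle algebra *)

Lemma stuffle_bvec u v :
  stuffle (bvec u) (bvec v) = \sum_(w <- stuffles u v) bvec w.
Proof.
rewrite /stuffle bilinext_bvec; apply: eq_bigr => w _; by rewrite bvecE.
Qed.

Lemma stuffle_linearl v : linear (stuffle^~ v).
Proof. by move=> a x y; rewrite /stuffle bilinextDl bilinextZl. Qed.

Lemma stuffle_linearr u : linear (stuffle u).
Proof. by move=> a x y; rewrite /stuffle bilinextDr bilinextZr. Qed.

Lemma stuffle_nill y : stuffle (bvec [::]) y = y.
Proof.
apply: (linear_ext (f := bilinext _ (bvec [::])) (g := idfun)) => v /=.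
by rewrite -/(stuffle _ _) stuffle_bvec; case: v => [|b v]; rewrite big_seq1.
Qed.

Lemma stuffle_nilr x : stuffle x (bvec [::]) = x.
Proof.
apply: (linear_ext (f := bilinextl _ (bvec [::])) (g := idfun)) => u /=.
by rewrite /bilinextl -/(stuffle _ _) stuffle_bvec; case: u => [|b u]; rewrite big_seq1.
Qed.

Lemma stuffle_prepend a b x y :
  stuffle (prepend a x) (prepend b y)
  = prepend a (stuffle x (prepend b y)) + prepend b (stuffle (prepend a x) y)
    + prepend (ladd a b) (stuffle x y).
Proof.
pose F (u v : composition) : calH := \sum_(w <- stuffles u v) << w >>.
apply: (linear_ext (f := bilinextl F (prepend b y) \o prepend a)
  (g := (prepend a \o bilinextl F (prepend b y))
        \+ (prepend b \o (bilinextl F y \o prepend a))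
        \+ (prepend (ladd a b) \o bilinextl F y))) => u {x} /=.
rewrite /bilinextl.
apply: (linear_ext (f := bilinext F (prepend a (bvec u)) \o prepend b)
  (g := (prepend a \o (bilinext F (bvec u) \o prepend b))
        \+ (prepend b \o bilinext F (prepend a (bvec u)))
        \+ (prepend (ladd a b) \o bilinext F (bvec u)))) => v {y} /=.
rewrite !prependU -!/(stuffle _ _) !stuffle_bvec /= !big_cat !big_map /=.
rewrite ![prepend _ (\sum_(_ <- _) _)]linear_sum /= addrA.
by congr (_ + _); first congr (_ + _); apply: eq_bigr => w _; rewrite prependU.
Qed.

Lemma mcoeff_prepend_nil a x : (prepend a x)@_([::] : composition) = 0.
Proof.
apply/mcoeff_outdom/negP => x0.
suff : supported (fun s => s != [::]) (prepend a x) by move/(_ _ x0).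
by apply: supported_lin => s _ /=; rewrite prependU; apply: supportedU.
Qed.

Definition coef (K : choiceType) (k : K) (u : {malg rat[K]}) : rat^o := u@_k.

Lemma coef_is_linear (K : choiceType) (k : K) : linear (coef k).
Proof. by move=> a u v; rewrite /coef mcoeffD mcoeffZ. Qed.

HB.instance Definition _ (K : choiceType) (k : K) :=
  GRing.isLinear.Build rat {malg rat[K]} rat^o *:%R (coef k) (coef_is_linear k).

Lemma mcoeff_tens x y s t : (tens x y)@_(s, t) = x@_s * y@_t.
Proof.
pose F (s t : composition) : calH2 := << (s, t) >>.
rewrite -!/(coef _ _) mulrC.
apply: (linear_ext (f := coef (s, t) \o bilinextl F y) (g := y@_t \*: coef s)).
move=> u {x} /=; rewrite /bilinextl -[RHS]/(_ * _) mulrC.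
apply: (linear_ext (f := coef (s, t) \o bilinext F (bvec u))
  (g := (bvec u)@_s \*: coef t)) => v {y} /=.
rewrite bilinext_bvec /F -bvecE /coef -[RHS]/(_ * _) !mcoeff_bvec xpair_eqE.
by rewrite -natrM mulnb.
Qed.

Definition prepend_left a : calH2 -> calH2 := linext (fun p => bvec (a :: p.1, p.2)).
HB.instance Definition _ a := GRing.Linear.on (prepend_left a).

Lemma tens_bvec s t : tens (bvec s) (bvec t) = bvec (s, t).
Proof. by rewrite !bvecE tensU. Qed.

Lemma prepend_left_tens a x y : prepend_left a (tens x y) = tens (prepend a x) y.
Proof.
apply: (linear_ext (f := prepend_left a \o tensl y) (g := tensl y \o prepend a)) => s {x} /=.
rewrite /tensl.
apply: (linear_ext (f := prepend_left a \o tens (bvec s)) (g := tens (prepend a (bvec s)))) => t /=.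
by rewrite prependU !tens_bvec /prepend_left linext_bvec.
Qed.

HB.instance Definition _ := GRing.Linear.copy Delta_dec
  (linext (fun s => \sum_(i < (size s).+1) << (take i s, drop i s) >>)).

Lemma Delta_dec_bvec s : Delta_dec (bvec s) = \sum_(p <- splits s) bvec p.
Proof.
rewrite /Delta_dec linext_bvec -(sum_splits (fun x y => << (x, y) >>)).
by apply: eq_bigr => -[x y] _; rewrite bvecE.
Qed.

Lemma Delta_dec_prepend a x :
  Delta_dec (prepend a x) = tens (bvec [::]) (prepend a x) + prepend_left a (Delta_dec x).
Proof.
apply: (linear_ext (f := Delta_dec \o prepend a)
  (g := (tens (bvec [::]) \o prepend a) \+ (prepend_left a \o Delta_dec))) => s /=.
rewrite prependU !Delta_dec_bvec tens_bvec sum_splits_cons [prepend_left _ _]linear_sum.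
by congr (_ + _); apply: eq_bigr => p _; rewrite /= /prepend_left linext_bvec.
Qed.

(** A nonempty word is recovered from its cut after the first letter, so
[Delta_dec] determines all coefficients except that of the empty word. *)
Lemma mcoeff_Delta_dec x a t :
  (Delta_dec x)@_([:: a], t) = x@_(a :: t).
Proof.
apply: (linear_ext (f := coef ([:: a], t) \o Delta_dec) (g := coef (a :: t))).
move=> s /=; rewrite Delta_dec_bvec /coef raddf_sum mcoeff_bvec /=.
under eq_bigr => p _ do rewrite mcoeff_bvec.
case: s => [|b s]; first by rewrite big_seq1.
rewrite sum_splits_cons add0r splitsE big_cons /= big1_seq ?addr0.
  by rewrite xpair_eqE !eqseq_cons andbT.
case: s => [|c s] p //; rewrite nonnil_splits_cons => /mapP[q _ ->].
by rewrite xpair_eqE eqseq_cons andbF.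
Qed.

Lemma nonnil_splits_size (T : eqType) (s : seq T) p : p \in nonnil_splits s ->
  [/\ p.1 != [::], s = p.1 ++ p.2 & (size p.2 < size s)%N].
Proof.
elim: s p => [|a s IH] p //.
rewrite nonnil_splits_cons => /mapP[q]; rewrite splitsE inE => /orP[/eqP->|/IH[_ e sq]] -> /=.
  by split.
by split; rewrite // ?[in LHS]e // ltnS ltnW.
Qed.

Section BlockMap.

Variable c : composition -> rat.

Definition block (s : composition) : letter := insubd lone (weight s).

(** [n] bounds the length of the word and makes the recursion structural. *)
Fixpoint block_sum_rec (n : nat) (s : composition) : calH :=
  if n is n'.+1 then
    if s is [::] then bvec [::]
    else \sum_(p <- nonnil_splits s) c p.1 *: prepend (block p.1) (block_sum_rec n' p.2)
  else bvec [::].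

Definition block_sum (s : composition) : calH := block_sum_rec (size s) s.

Lemma block_sum_recE n s : (size s <= n)%N -> block_sum_rec n s = block_sum s.
Proof.
rewrite /block_sum; have [m sm] := ubnP (size s).
elim: m s sm n => [|m IH] s sm n sn; first by rewrite ltn0 in sm.
case: s sm sn => [|a s] sm sn; first by case: n {sn}.
case: n sn => [|n] sn; first by rewrite ltn0 in sn.
rewrite /=.
apply: eq_big_seq => p /nonnil_splits_size[_ _ sp]; congr (_ *: prepend _ _).
have sp1 : (size p.2 <= size s)%N by [].
rewrite (IH p.2 _ n) ?(IH p.2 _ (size s)) //.
- exact: leq_ltn_trans sp1 sm.
- exact: leq_ltn_trans sp1 sm.
- exact: leq_trans sp1 sn.
Qed.

Lemma block_sum_first s : s != [::] ->
  block_sum s = \sum_(p <- nonnil_splits s) c p.1 *: prepend (block p.1) (block_sum p.2).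
Proof.
case: s => [|a s] s0; first by rewrite eqxx in s0.
rewrite {1}/block_sum /=.
apply: eq_big_seq => p /nonnil_splits_size[_ _ sp].
by rewrite block_sum_recE.
Qed.

(** Peel off the first block; what is left is coassociativity of cutting, applied
to a cut that falls between two blocks. *)
Lemma Delta_dec_block_sum s :
  Delta_dec (block_sum s) = \sum_(p <- splits s) tens (block_sum p.1) (block_sum p.2).
Proof.
have [m] := ubnP (size s); elim: m s => // m IH s sm.
have [->|s0] := eqVneq s [::].
  by rewrite Delta_dec_bvec !big_seq1 tens_bvec.
rewrite splitsE big_cons /= {1}(block_sum_first s0) linear_sum.
transitivity (tens (bvec [::]) (block_sum s) +
  \sum_(p <- nonnil_splits s) \sum_(q <- splits p.2)
    c p.1 *: tens (prepend (block p.1) (block_sum q.1)) (block_sum q.2)).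
  rewrite [in RHS](block_sum_first s0) [tens _ _]linear_sum -big_split.
  apply: eq_big_seq => p /nonnil_splits_size[_ _ sp] /=.
  rewrite linearZ /= Delta_dec_prepend scalerDr tensZr; congr (_ + _).
  rewrite (IH p.2) ?(leq_trans sp) // [prepend_left _ _]linear_sum scaler_sumr.
  by apply: eq_bigr => q _; rewrite /= prepend_left_tens.
congr (_ + _).
rewrite (nonnil_splits_coassoc
  (fun x y z => c x *: tens (prepend (block x) (block_sum y)) (block_sum z))).
apply: eq_big_seq => p /nonnil_splits_size[p0 _ _].
rewrite (block_sum_first p0) -[RHS]/(tensl _ _) linear_sum.
by apply: eq_bigr => q _; rewrite linearZ.
Qed.

Lemma val_block s : s != [::] -> val (block s) = weight s.
Proof.
by case: s => // a s _; rewrite val_insubd /weight /= ltn_addr // (valP a).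
Qed.

Lemma block_sum_weight s : supported (fun t => weight t = weight s) (block_sum s).
Proof.
have [m] := ubnP (size s); elim: m s => // m IH s sm.
have [->|s0] := eqVneq s [::]; first exact: supportedU.
rewrite (block_sum_first s0); apply: supported_sum => p /nonnil_splits_size[p0 e sp].
apply: supportedZ; apply: supported_lin => t ht /=; rewrite prependU; apply: supportedU.
have wt : weight t = weight p.2 by apply: (IH p.2); rewrite ?(leq_trans sp).
rewrite e /weight map_cat sumn_cat -/(weight p.2) -wt -/(weight p.1).
by rewrite -(val_block p0).
Qed.

Definition diag_coef (s : composition) : rat := \prod_(a <- s) c [:: a].

Lemma block1 a : block [:: a] = a.
Proof. by apply: val_inj; rewrite val_block // /weight /= addn0. Qed.

(** Only the cut into single letters preserves the length. *)
Lemma block_sum_triangular s :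
  supported (fun t => (size t < size s)%N) (block_sum s - diag_coef s *: bvec s).
Proof.
have [m] := ubnP (size s); elim: m s => // m IH [|a s] sm.
  by rewrite /diag_coef big_nil scale1r subrr; apply: supported0.
have block_sumW r : (size r <= size s)%N ->
    supported (fun t => (size t <= size r)%N) (block_sum r).
  move=> rs; rewrite -[block_sum r](subrK (diag_coef r *: bvec r)).
  apply: supportedD; last by apply: supportedZ; apply: supportedU.
  by apply: (supportedW _ (IH r _)) => [t /ltnW //|]; apply: leq_ltn_trans rs _.
rewrite (@block_sum_first (a :: s) isT) nonnil_splits_cons big_map splitsE big_cons /=.
rewrite block1 addrAC; apply: supportedD; last first.
  apply: supported_sum => p /nonnil_splits_size[_ _ sp]; apply: supportedZ.
  apply: supported_lin => t tp; rewrite /= prependU; apply: supportedU => /=.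
  by rewrite ltnS; apply: leq_ltn_trans (sp); apply: (block_sumW _ (ltnW sp)).
rewrite /diag_coef big_cons -scalerA -prependU -scalerBr; apply: supportedZ.
have -> : prepend a (block_sum s) - diag_coef s *: prepend a (bvec s)
    = prepend a (block_sum s - diag_coef s *: bvec s).
  by rewrite [RHS]linearB /= [prepend a (_ *: _)]linearZ.
apply: supported_lin => t ts; rewrite /= prependU; apply: supportedU.
by rewrite /= ltnS; apply: (IH s).
Qed.

Lemma counit_block_sum s : (block_sum s)@_([::] : composition) = (s == [::])%:R.
Proof.
have [->|s0] := eqVneq s [::]; first by rewrite mcoeff_bvec.
rewrite (block_sum_first s0) raddf_sum big1 // => p _.
by rewrite /= mcoeffZ mcoeff_prepend_nil mulr0.
Qed.

Lemma chiQ_prepend a x : chiQ (prepend a x) = x@_([::] : composition).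
Proof.
apply: (linear_ext (f := chiQ \o prepend a) (g := coef ([::] : composition))) => s /=.
by rewrite prependU /chiQ linext_bvec /coef mcoeff_bvec; case: s.
Qed.

Hypothesis c_nil : c [::] = 1.

(** [chiQ] only sees words of length at most 1, that is the cut with one block. *)
Lemma chiQ_block_sum s : chiQ (block_sum s) = c s.
Proof.
have [->|s0] := eqVneq s [::]; first by rewrite /chiQ linext_bvec c_nil.
rewrite (block_sum_first s0) linear_sum.
under eq_bigr => p _ do rewrite linearZ /= chiQ_prepend counit_block_sum.
case: s s0 => // a s _; rewrite nonnil_splits_cons big_map /=.
have last_split (g : composition -> rat^o) r :
    \sum_(p <- splits r) g p.1 *: ((p.2 == [::])%:R : rat^o) = g r.
  elim: r g => [|b r IH] g; first by rewrite big_seq1 [LHS]mulr1.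
  by rewrite sum_splits_cons /= scaler0 add0r (IH (fun x => g (b :: x))).
exact: (last_split (fun x => c (a :: x))).
Qed.

Hypothesis c_mul : forall s t, c s * c t = \sum_(r <- interleave s t) c r.

(** Remove the first block from both factors.  The three terms of the quasi-shuffle
recursion match the three kinds of prefixes of a shuffle; when the prefix mixes
letters of both words, multiplicativity of [c] sums over its shuffles and the
two block weights add up. *)
Lemma stuffle_block_sum s t :
  stuffle (block_sum s) (block_sum t) = \sum_(r <- interleave s t) block_sum r.
Proof.
have [m] := ubnP (size s + size t); elim: m s t => // m IH s t sm.
have [->|s0] := eqVneq s [::]; first by rewrite interleave0s big_seq1 stuffle_nill.
have [->|t0] := eqVneq t [::]; first by rewrite interleaves0 big_seq1 stuffle_nilr.
pose g x y := c x *: prepend (block x) (block_sum y).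
transitivity (\sum_(r <- interleave s t) \sum_(p <- nonnil_splits r) g p.1 p.2); last first.
  apply: eq_big_seq => r /interleave_weight wr; rewrite -block_sum_first //.
  apply: contraTneq (valP (block s)) => r0; rewrite val_block // -leqNgt leqn0.
  by move/esym/eqP: wr; rewrite r0 addn_eq0 => /andP[].
have size_l p : p \in nonnil_splits s -> (size p.2 + size t < m)%N.
  move=> /nonnil_splits_size[_ _ sp]; apply: leq_trans (_ : size s + size t <= m)%N => //.
  by rewrite ltn_add2r.
have size_r q : q \in nonnil_splits t -> (size s + size q.2 < m)%N.
  move=> /nonnil_splits_size[_ _ sq]; apply: leq_trans (_ : size s + size t <= m)%N => //.
  by rewrite ltn_add2l.
have prepend_sum a u (r : seq composition) :
    \sum_(y <- r) u *: prepend a (block_sum y) = u *: prepend a (\sum_(y <- r) block_sum y).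
  by rewrite [prepend _ _]linear_sum scaler_sumr.
pose w (p q : composition * composition) := c p.1 * c q.1.
pose letter_of (p : composition * composition) := block p.1.
have left_first : \sum_(p <- nonnil_splits s) \sum_(y <- interleave p.2 t) g p.1 y
    = \sum_(p <- nonnil_splits s) \sum_(q <- nonnil_splits t) w p q *:
        prepend (letter_of p) (stuffle (block_sum p.2) (prepend (letter_of q) (block_sum q.2))).
  apply: eq_big_seq => p ps; rewrite prepend_sum -(IH _ _ (size_l p ps)).
  rewrite (block_sum_first t0) {1}/stuffle bilinext_sumr [prepend _ _]linear_sum.
  rewrite scaler_sumr; apply: eq_bigr => q _.
  by rewrite bilinextZr -/stuffle linearZ scalerA.
have right_first : \sum_(q <- nonnil_splits t) \sum_(y <- interleave s q.2) g q.1 y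
    = \sum_(p <- nonnil_splits s) \sum_(q <- nonnil_splits t) w p q *:
        prepend (letter_of q) (stuffle (prepend (letter_of p) (block_sum p.2)) (block_sum q.2)).
  rewrite exchange_big; apply: eq_big_seq => q qt.
  rewrite prepend_sum -(IH _ _ (size_r q qt)).
  rewrite (block_sum_first s0) {1}/stuffle bilinext_suml [prepend _ _]linear_sum.
  rewrite scaler_sumr; apply: eq_bigr => p _.
  by rewrite bilinextZl -/stuffle linearZ scalerA mulrC.
have both_first : \sum_(p <- nonnil_splits s) \sum_(q <- nonnil_splits t)
      \sum_(x <- interleave p.1 q.1) \sum_(y <- interleave p.2 q.2) g x y
    = \sum_(p <- nonnil_splits s) \sum_(q <- nonnil_splits t) w p q *:
        prepend (ladd (letter_of p) (letter_of q)) (stuffle (block_sum p.2) (block_sum q.2)).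
  apply: eq_big_seq => p ps; apply: eq_big_seq => q qt.
  have [p0 _ _] := nonnil_splits_size ps; have [q0 _ sq] := nonnil_splits_size qt.
  rewrite IH; last by apply: ltn_trans (size_l p ps); rewrite ltn_add2l.
  rewrite /w c_mul scaler_suml; apply: eq_big_seq => x /interleave_weight wx.
  rewrite prepend_sum; congr (_ *: prepend _ _); apply: val_inj.
  rewrite val_block /= ?val_block //.
  apply: contraTneq (valP (block p.1)) => x0; rewrite val_block // -leqNgt leqn0.
  by move/esym/eqP: wx; rewrite x0 addn_eq0 => /andP[].
rewrite nonnil_splits_interleave left_first right_first both_first.
rewrite (block_sum_first s0) (block_sum_first t0) {1}/stuffle bilinext_suml.
rewrite -!big_split /=; apply: eq_bigr => p _.
rewrite bilinext_sumr -!big_split /=; apply: eq_bigr => q _.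
rewrite bilinextZl bilinextZr -/stuffle scalerA -/(w p q) stuffle_prepend.
by rewrite !scalerDr.
Qed.

End BlockMap.

(** * The character and the isomorphism *)

Lemma size_shuffles u v : size (shuffles u v) = 'C(size u + size v, size u).
Proof.
elim: u v => [|a u IHu] v; first by case: v => [|b v]; rewrite bin0.
elim: v => [|b v IHv]; first by rewrite /= addn0 binn.
by rewrite size_cat !size_map IHu IHv /= !addSn addnS binS addnC.
Qed.

Lemma size_shuffle_mem u v w : w \in shuffles u v -> size w = (size u + size v)%N.
Proof.
elim: u v w => [|a u IHu] v w; first by case: v => [|b v]; rewrite inE => /eqP->.
elim: v w => [|b v IHv] w; first by rewrite inE => /eqP->; rewrite addn0.
rewrite mem_cat => /orP[] /mapP[x].
  by move=> /IHu sx -> /=; rewrite sx.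
by move=> /IHv sx -> /=; rewrite sx addnS.
Qed.

Lemma size_rho_word s : size (rho_word s) = weight s.
Proof.
elim: s => // a s IH; rewrite rho_word_cons size_cat size_nseq /= IH /weight /=.
by case: a => -[|n] //= _; rewrite addnS.
Qed.

Lemma chi0_bvec s : chi0 (bvec s) = ((weight s)`!)%:R^-1.
Proof. by rewrite /chi0 linext_bvec. Qed.

Lemma shb_linearl v : linear (shb^~ v).
Proof.
move=> a x y; rewrite /shb linearP /shuffle bilinextDl bilinextZl.
exact: (linearP unrho).
Qed.

Lemma shb_linearr u : linear (shb u).
Proof.
move=> a x y; rewrite /shb linearP /shuffle bilinextDr bilinextZr.
exact: (linearP unrho).
Qed.

Lemma shb_bvec s t :
  shb (bvec s) (bvec t)
  = \sum_(w <- shuffles (rho_word s) (rho_word t)) bvec (unrho_word w).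
Proof.
rewrite /shb !rho_bvec shuffle_bvec linear_sum; apply: eq_bigr => w _.
by rewrite /= /unrho linext_bvec bvecE.
Qed.

(** By linearity this is the count of shuffles: binomial(m + n, m) / (m + n)!
equals 1 / (m! n!). *)
Lemma chi0_shb u v : chi0 (shb u v) = chi0 u * chi0 v.
Proof.
apply: (bilinear_ext (f := fun u v => chi0 (shb u v))
  (g := fun u v => chi0 u * chi0 v : rat^o)) => [{}u|{}v|{}u|{}v|s t] .
- by move=> a x y; rewrite shb_linearr linearP.
- by move=> a x y; rewrite shb_linearl linearP.
- by move=> a x y; rewrite linearP mulrDr; congr (_ + _); rewrite mulrCA.
- by move=> a x y; rewrite linearP mulrDl; congr (_ + _); rewrite -mulrA.
rewrite shb_bvec linear_sum !chi0_bvec.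
rewrite (eq_big_seq (fun=> ((weight s + weight t)`!)%:R^-1)) => [|w ws] /=.
  rewrite big_const_seq count_predT iter_addr_0 size_shuffles !size_rho_word.
  have /(congr1 (fun n => n%:R : rat)) := bin_fact (leq_addr (weight t) (weight s)).
  rewrite addKn !natrM => <-.
  have f0 n : (n`!)%:R != 0 :> rat by rewrite Num.Theory.pnatr_eq0 -lt0n fact_gt0.
  have b0 : 'C(weight s + weight t, weight s)%:R != 0 :> rat.
    by rewrite Num.Theory.pnatr_eq0 -lt0n bin_gt0 leq_addr.
  by rewrite -[LHS]mulr_natl invfM mulVKf // invfM.
have ew := ends_shuffles (ends_rho_word s) (ends_rho_word t) ws.
by rewrite chi0_bvec -size_rho_word unrho_wordK // (size_shuffle_mem ws) !size_rho_word.
Qed.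

Lemma unitHE : unitH = bvec [::].
Proof. by rewrite bvecE. Qed.

Lemma chi0_character : is_character shb chi0.
Proof. by split; [rewrite unitHE /= chi0_bvec invr1 | exact: chi0_shb]. Qed.

Definition chi0_brace (s : composition) : rat := chi0 (brace s).

Lemma chi0_brace_nil : chi0_brace [::] = 1.
Proof. by rewrite /chi0_brace (brace_ones 0) chi0_bvec invr1. Qed.

Lemma chi0_brace_mul s t :
  chi0_brace s * chi0_brace t = \sum_(r <- interleave s t) chi0_brace r.
Proof. by rewrite /chi0_brace -chi0_shb shb_brace linear_sum. Qed.

Lemma brace1 a : brace [:: a] = bvec [:: a].
Proof.
apply/malgP => s; rewrite -[brace _](subrK (bvec [:: a])) mcoeffD.
rewrite [X in X + _](_ : _ = 0) ?add0r //; apply/mcoeff_outdom/negP.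
by move/(@brace_triangular [:: a]) => [].
Qed.

Lemma chi0_brace1 a : chi0_brace [:: a] != 0.
Proof.
rewrite /chi0_brace brace1 chi0_bvec invr_eq0.
by rewrite Num.Theory.pnatr_eq0 -lt0n fact_gt0.
Qed.

Definition block_sum_lin : calH -> calH := linext (block_sum chi0_brace).
HB.instance Definition _ := GRing.Linear.on block_sum_lin.

Lemma block_sum_linU s : block_sum_lin (bvec s) = block_sum chi0_brace s.
Proof. exact: linext_bvec. Qed.

Lemma block_sum_lin_bij : bijective block_sum_lin.
Proof.
apply: (@triangular_bij _ size (diag_coef chi0_brace) block_sum_lin) => [s|s].
  by rewrite prodf_seq_neq0; apply/allP => a _; apply: chi0_brace1.
by rewrite /= block_sum_linU; apply: block_sum_triangular.
Qed.

(** Turns homogeneity into the linear equation weight_proj n u = u, which can be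
tested on any basis of homogeneous elements. *)
Definition weight_proj (n : nat) : calH -> calH :=
  linext (fun s => if weight s == n then bvec s else 0).
HB.instance Definition _ n := GRing.Linear.on (weight_proj n).

Lemma homogeneousP n u : homogeneous n u <-> weight_proj n u = u.
Proof.
split=> [un|<-].
  apply: (@linear_ext_supp _ _ (weight_proj n) idfun) => s /un ws /=.
  by rewrite /weight_proj linext_bvec ws eqxx.
apply: supported_linext => s _.
by case: eqP => [ws|_]; [apply: supportedU | apply: supported0].
Qed.

Lemma weight_proj_homogeneous m n u : homogeneous m u ->
  weight_proj n u = if m == n then u else 0.
Proof.
move=> um; case: eqP => [<-|/eqP mn]; first exact/homogeneousP.
apply: (@linear_ext_supp _ _ (weight_proj n) \0) => s /um ws /=.
by rewrite /weight_proj linext_bvec ws (negPf mn).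
Qed.

Lemma brace_ext (V : lmodType rat) (f g : {linear calH -> V}) :
  (forall s, f (brace s) = g (brace s)) -> f =1 g.
Proof.
move=> fg u; have [Pinv _ PinvK] := brace_lin_bij; rewrite -(PinvK u).
apply: (linear_ext (f := f \o brace_lin) (g := g \o brace_lin)) => s /=.
by rewrite brace_linU fg.
Qed.

Lemma brace_homogeneous s : homogeneous (weight s) (brace s).
Proof. by move=> t /(@brace_shape s) []. Qed.

Definition tens_mapl (f g : {linear calH -> calH}) := tens_map f g.
HB.instance Definition _ f g := GRing.Linear.copy (tens_mapl f g)
  (linext (fun st => tens (f << st.1 >>) (g << st.2 >>))).

Lemma tens_map_tens (f g : {linear calH -> calH}) x y :
  tens_map f g (tens x y) = tens (f x) (g y).
Proof.
apply: (linear_ext (f := tens_mapl f g \o tensl y) (g := tensl (g y) \o f)) => s {x} /=.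
apply: (linear_ext (f := tens_mapl f g \o tens (bvec s))
  (g := tens (f (bvec s)) \o g)) => t /=.
by rewrite tens_bvec /tens_mapl /tens_map linext_bvec /= !bvecE.
Qed.

Lemma brace_to_block_sum_exists :
  exists2 Psi : {linear calH -> calH},
    forall s, Psi (brace s) = block_sum chi0_brace s & bijective Psi.
Proof.
have [Pinv brace_linK PinvK] := brace_lin_bij.
pose PinvL : {linear calH -> calH} :=
  HB.pack Pinv (GRing.isLinear.Build _ _ _ _ Pinv (can2_linear brace_linK PinvK)).
exists (block_sum_lin \o PinvL) => [s|].
  by rewrite /= -brace_linU brace_linK block_sum_linU.
by apply: (bij_comp block_sum_lin_bij); exists brace_lin.
Qed.

Section Main.

Variable Delta : {linear calH -> calH2}.
Hypothesis HDelta : is_Delta_ge1 Delta.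

Lemma Delta_brace_splits s :
  Delta (brace s) = \sum_(p <- splits s) tens (brace p.1) (brace p.2).
Proof.
by rewrite (Delta_brace HDelta) (sum_splits (fun x y => tens (brace x) (brace y))).
Qed.

(** Each axiom is linear in its arguments, so it is enough to test it on braces,
where source and target structure maps are both given by shuffling and cutting. *)
Lemma brace_to_block_sum_Psi (Psi : {linear calH -> calH}) :
  (forall s, Psi (brace s) = block_sum chi0_brace s) -> is_Psi Delta chi0 Psi.
Proof.
move=> PsiB; split; first split.
- by rewrite unitHE -(brace_ones 0) PsiB (brace_ones 0).
- have [Pinv _ PinvK] := brace_lin_bij => u v; rewrite -(PinvK u) -(PinvK v).
  apply: (bilinear_ext (f := fun u v => Psi (shb (brace_lin u) (brace_lin v)))
    (g := fun u v => stuffle (Psi (brace_lin u)) (Psi (brace_lin v)))).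
  + by move=> x a y z; rewrite linearP shb_linearr linearP.
  + by move=> x a y z; rewrite linearP shb_linearl linearP.
  + by move=> x a y z; rewrite !linearP stuffle_linearr.
  + by move=> x a y z; rewrite !linearP stuffle_linearl.
  move=> s t; rewrite !brace_linU shb_brace !PsiB linear_sum.
  rewrite (stuffle_block_sum chi0_brace_mul); apply: eq_bigr => r _.
  exact: PsiB.
- apply: (brace_ext (f := coef ([::] : composition) \o Psi)
    (g := coef ([::] : composition))) => s /=.
  rewrite PsiB /coef counit_block_sum; have [->|s0] := eqVneq s [::].
    by rewrite (brace_ones 0) mcoeff_bvec.
  apply/esym/mcoeff_outdom/negP => /(@brace_shape s) [/esym/eqP].
  by rewrite size_eq0 (negPf s0).
- apply: (brace_ext (f := Delta_dec \o Psi) (g := tens_mapl Psi Psi \o Delta)) => s /=.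
  rewrite PsiB Delta_dec_block_sum Delta_brace_splits [RHS]linear_sum.
  by apply: eq_bigr => p _; rewrite /= [RHS]tens_map_tens !PsiB.
- move=> n u /homogeneousP un; apply/homogeneousP; rewrite -{2}un.
  apply: (brace_ext (f := weight_proj n \o Psi) (g := Psi \o weight_proj n)) => s /=.
  rewrite PsiB (weight_proj_homogeneous _ (@brace_homogeneous s)).
  rewrite (weight_proj_homogeneous _ (@block_sum_weight chi0_brace s)).
  by case: eqP => _; rewrite ?PsiB ?linear0.
- apply: (brace_ext (f := chiQ \o Psi) (g := chi0)) => s /=.
  by rewrite PsiB (chiQ_block_sum chi0_brace_nil).
Qed.

(** Among words of positive weight n, [chiQ] only sees the one-letter word [n]. *)
Lemma mcoeff_homogeneous1 n u a : homogeneous n u -> (0 < n)%N ->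
  u@_[:: a] = if val a == n then chiQ u else 0.
Proof.
move=> un n_gt0; case: eqP => [an|na].
  apply: (@linear_ext_supp _ _ (coef [:: a]) chiQ) => s /un ws /=.
  rewrite /coef mcoeff_bvec /chiQ linext_bvec.
  case: s ws => [|b [|b' s]] ws; first by rewrite -ws in n_gt0.
    congr (nat_of_bool _)%:R; apply/eqP; congr [:: _]; apply: val_inj.
    by rewrite an -ws /weight /= addn0.
  by rewrite eqseq_cons andbF.
apply/mcoeff_outdom/negP => /un ws; apply: na.
by rewrite -ws /weight /= addn0.
Qed.

(** Induction on the length.  The coefficient at a :: t is that of [a] tensor t in
the deconcatenation of the image, hence a sum over the cuts of s of a factor
fixed by the character and the grading and a factor for a shorter word. *)
Lemma Psi_unique (P1 P2 : {linear calH -> calH}) :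
  is_Psi Delta chi0 P1 -> is_Psi Delta chi0 P2 -> P1 =1 P2.
Proof.
move=> H1 H2; apply: brace_ext => s.
have [n] := ubnP (size s); elim: n s => // n IH s sn.
have unit_case (P : {linear calH -> calH}) : is_Psi Delta chi0 P ->
  P (brace [::]) = bvec [::].
  by move=> [[P1u _ _ _] _ _]; rewrite (brace_ones 0) -unitHE.
have [->|s0] := eqVneq s [::]; first by rewrite !unit_case.
have coefP (P : {linear calH -> calH}) : is_Psi Delta chi0 P -> forall a t,
    (P (brace s))@_(a :: t) = \sum_(p <- nonnil_splits s)
      (if val a == weight p.1 then chi0 (brace p.1) else 0) * (P (brace p.2))@_t.
  move=> HP a t; have [[_ _ _ comul] graded chiP] := HP.
  rewrite -mcoeff_Delta_dec comul Delta_brace_splits.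
  have coef_tens x y :
      (tens_mapl P P (tens x y))@_([:: a], t) = (P x)@_[:: a] * (P y)@_t.
    by rewrite /tens_mapl tens_map_tens mcoeff_tens.
  rewrite -[tens_map _ _]/(tens_mapl P P) linear_sum raddf_sum splitsE big_cons.
  rewrite [X in X + _](_ : _ = 0); last first.
    by rewrite [LHS]coef_tens (unit_case P HP) mcoeff_bvec mul0r.
  rewrite add0r; apply: eq_big_seq => p /nonnil_splits_size[p0 _ _].
  rewrite [LHS]coef_tens; congr (_ * _).
  rewrite (mcoeff_homogeneous1 a (graded _ _ (@brace_homogeneous p.1))) ?chiP //.
  by case: (p.1) p0 => // b r _; rewrite /weight /= ltn_addr // (valP b).
apply/malgP => -[|a t]; last first.
  rewrite !coefP //; apply: eq_big_seq => p /nonnil_splits_size[_ _ sp].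
  by rewrite (IH p.2) // (leq_trans sp).
have [[_ _ counit1 _] _ _] := H1; have [[_ _ counit2 _] _ _] := H2.
exact: (etrans (counit1 (brace s)) (esym (counit2 (brace s)))).
Qed.

End Main.

Theorem theorem3p13 (Delta : {linear calH -> calH2}) (HDelta : is_Delta_ge1 Delta) :
  is_character shb chi0 /\
  exists Psi : {linear calH -> calH},
    [/\ is_Psi Delta chi0 Psi,
        (forall Psi' : {linear calH -> calH}, is_Psi Delta chi0 Psi' -> Psi' =1 Psi)
      & is_hopf_iso shb Delta stuffle Delta_dec Psi].
Proof.
split; first exact: chi0_character.
have [Psi PsiB Psi_bij] := brace_to_block_sum_exists.
have HPsi := brace_to_block_sum_Psi HDelta PsiB.
exists Psi; split=> // [Psi' HPsi'|]; first exact: (Psi_unique HDelta HPsi' HPsi).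
by split=> //; case: HPsi.
Qed.
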